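(* Let $\Phi$ be a non vanishing vector field in $C^1_\sharp(Y_d)^d$ (i.e. $\Phi(x)\ne 0_{\mathbb{R}^d}$ for every $x$). Then $$\big\{\rho\in C^1_\sharp(Y_d):\rho>0\text{ and }\#\,\mathsf{C}_{\rho\Phi}=1\big\}=\big\{\rho\in C^1_\sharp(Y_d):\rho>0\text{ and }\#\,\mathsf{A}_{\rho\Phi}=1\big\},$$ and this set is a closed subset of $\big\{\rho\in C^1_\sharp(Y_d):\rho>0\big\}$ for the uniform convergence topology of $C^0_\sharp(Y_d)$.
   Context: $Y_d=\mathbb{R}^d/\mathbb{Z}^d$ is the $d$-dimensional torus, identified with $[0,1)^d$. $C^k_\sharp(Y_d)$ is the space of real-valued $\mathbb{Z}^d$-periodic functions in $C^k(\mathbb{R}^d)$. For $b\in C^1_\sharp(Y_d)^d$, the flow $X:\mathbb{R}\times\mathbb{R}^d\to\mathbb{R}^d$ associated with $b$ is the solution of $\partial_t X(t,x)=b(X(t,x))$, $t\in\mathbb{R}$, $X(0,x)=x$; it satisfies $X(t,x+\kappa)=X(t,x)+\kappa$ for $\kappa\in\mathbb{Z}^d$, so it induces a flow on $Y_d$. A probability measure $\mu$ on $Y_d$ is invariant for the flow $X$ if $\int_{Y_d}\psi(X(t,y))\,d\mu(y)=\int_{Y_d}\psi(y)\,d\mu(y)$ for all $t\in\mathbb{R}$ and $\psi\in C^0_\sharp(Y_d)$; $\mathscr{I}_b$ denotes the set of these invariant probability measures. The (Herman) rotation set is $\mathsf{C}_b:=\left\{\int_{Y_d}b(y)\,d\mu(y):\mu\in\mathscr{I}_b\right\}\subset\mathbb{R}^d$.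 Also $\mathsf{A}_b:=\bigcup_{x\in Y_d}\left[\bigcap_{n\ge1}\overline{\left\{X(k,x)/k:\ k\ge n,\ k\in\mathbb{N}\right\}}\right]$, the set of all limit points of the sequences $(X(n,x)/n)_{n\ge1}$, $x\in Y_d$. $\#$ denotes cardinality. *)

(* Defs.v *)
From HB Require Import structures.
From mathcomp Require Import all_boot all_order all_algebra.
From mathcomp Require Import all_classical all_reals all_analysis.

Set Implicit Arguments.
Unset Strict Implicit.
Unset Printing Implicit Defensive.

Import Order.TTheory GRing.Theory Num.Theory.
Import numFieldTopology.Exports numFieldNormedType.Exports.

Local Open Scope classical_set_scope.
Local Open Scope ring_scope.

(** Functions on the torus Y_d = R^d / Z^d are represented by their
    Z^d-periodic lifts to R^d = 'rV[R]_d. *)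

Definition periodic (R : realType) (d : nat) (T : Type)
    (f : 'rV[R]_d -> T) : Prop :=
  forall (x : 'rV[R]_d) (kappa : 'rV[int]_d),
    f (x + map_mx intr kappa) = f x.

Definition C0_sharp (R : realType) (d : nat) : set ('rV[R]_d -> R) :=
  [set f | continuous f /\ periodic f].
Arguments C0_sharp : clear implicits.

Definition C1_sharp (R : realType) (d : nat) : set ('rV[R]_d -> R) :=
  [set f | [/\ forall x, differentiable f x,
               forall v : 'rV[R]_d, continuous (fun x => 'D_v f x)
             & periodic f]].
Arguments C1_sharp : clear implicits.

Definition C1_sharp_field (R : realType) (d : nat)
    (b : 'rV[R]_d -> 'rV[R]_d) : Prop :=
  forall i : 'I_d, C1_sharp R d (fun x => b x 0 i).

(** The fundamental domain [0,1)^d, with which Y_d is identified. *)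
Definition torus (R : realType) (d : nat) : set 'rV[R]_d :=
  [set y | forall i : 'I_d, 0 <= y 0 i < 1].
Arguments torus : clear implicits.

Definition is_flow (R : realType) (d : nat) (b : 'rV[R]_d -> 'rV[R]_d)
    (X : R -> 'rV[R]_d -> 'rV[R]_d) : Prop :=
  forall x : 'rV[R]_d, X 0 x = x /\
    forall t : R, is_derive t (1 : R) (fun s : R => X s x) (b (X t x)).

(** For b in C^1_sharp(Y_d)^d the global flow exists and is unique
    (Cauchy-Lipschitz), so [flow b] is that flow; the default value of [xget]
    only matters for fields that have no global flow. *)
Definition flow (R : realType) (d : nat) (b : 'rV[R]_d -> 'rV[R]_d) :
    R -> 'rV[R]_d -> 'rV[R]_d :=
  xget ((fun _ x => x) : R -> 'rV[R]_d -> 'rV[R]_d) [set X | is_flow b X].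

Notation borelRd R d := (g_sigma_algebraType (@open 'rV[R]_d)).

(** Invariant probability measures on Y_d.  A Borel probability measure on the
    torus is a Borel probability measure on R^d carried by [0,1)^d: the
    quotient map restricts to a Borel isomorphism from [0,1)^d onto the
    torus.  The flow takes values in R^d, but since psi is periodic
    psi (flow b t y) is the value of psi at the class of flow b t y. *)
Definition invariant_probability (R : realType) (d : nat)
    (b : 'rV[R]_d -> 'rV[R]_d) (mu : probability (borelRd R d) R) : Prop :=
  mu (torus R d) = 1%E /\
  forall (t : R) (psi : 'rV[R]_d -> R), C0_sharp R d psi ->
    \int[mu]_(y in torus R d) psi (flow b t y) =
    \int[mu]_(y in torus R d) psi y.

Definition rotation_set (R : realType) (d : nat)
    (b : 'rV[R]_d -> 'rV[R]_d) : set 'rV[R]_d :=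
  [set \row_(i < d) (\int[mu]_(y in torus R d) b y 0 i)
    | mu in [set mu : probability (borelRd R d) R
            | invariant_probability b mu]].

(** Limit points of X(n,x)/n, where X is the flow on R^d, not reduced mod Z^d;
    by X(t,x+kappa) = X(t,x)+kappa they only depend on the class of x. *)
Definition asymptotic_set (R : realType) (d : nat)
    (b : 'rV[R]_d -> 'rV[R]_d) : set 'rV[R]_d :=
  \bigcup_(x in torus R d)
    \bigcap_(n in [set n : nat | (1 <= n)%N])
      closure [set (k%:R)^-1 *: flow b k%:R x | k in [set k : nat | (n <= k)%N]].

Definition C1_sharp_pos (R : realType) (d : nat) : set ('rV[R]_d -> R) :=
  [set rho | C1_sharp R d rho /\ forall x, 0 < rho x].
Arguments C1_sharp_pos : clear implicits.

Definition scale_field (R : realType) (d : nat) (rho : 'rV[R]_d -> R)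
    (Phi : 'rV[R]_d -> 'rV[R]_d) : 'rV[R]_d -> 'rV[R]_d :=
  fun x => rho x *: Phi x.

(** S is a closed subset of P for the topology on P induced by uniform
    convergence on R^d; on periodic functions this is uniform convergence on
    Y_d, i.e. the topology of C^0_sharp(Y_d). *)
Definition uniformly_closed_in (R : realType) (d : nat)
    (P S : set ('rV[R]_d -> R)) : Prop :=
  S `<=` P /\
  closed (S : set (subspace (P : set {uniform 'rV[R]_d -> R}))).

(* Main.v *)
From HB Require Import structures.
From mathcomp Require Import all_boot all_order all_algebra.
From mathcomp Require Import all_classical all_reals all_analysis.
From mathcomp Require Import measurable_realfun zify ring lra.
Require Import Defs.

Set Implicit Arguments.
Unset Strict Implicit.
Unset Printing Implicit Defensive.

Import Order.TTheory GRing.Theory Num.Theory.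
Import numFieldTopology.Exports numFieldNormedType.Exports.

Local Open Scope classical_set_scope.
Local Open Scope card_scope.
Local Open Scope ring_scope.

(** Write b for a field rho Phi, X for its flow, C for its rotation set and A for its
    asymptotic set.

    The equality of the two sets of densities follows from two facts, valid for every
    periodic Lipschitz field b.
    - A is contained in C (asymptotic_sub_rotation), by the argument of Krylov and
      Bogoliubov: averages of functions along longer and longer pieces of the orbit of
      x converge along an ultrafilter to a functional that is invariant under the flow,
      and, since X (k, x) - x is the integral of b along the orbit, its value on b is a
      limit point of X (k, x) / k.
    - If A is contained in {a}, so is C (rotation_sub_asymptotic): by compactness
      X (n, x) / n tends to a for every x, while invariance of a measure mu gives
      n times the integral of b as integral of X (n, y) - y; dominated convergence
      shows that the integral of b is a.
    As b is bounded, A is nonempty, and it follows that A and C are singletons for the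
    same densities.

    The invariant functional has to be turned into a measure (mean_representation).
    Points of the torus are coded by integers that describe finer and finer dyadic
    cubes; the functional gives a distribution function for the code of each level,
    and inverting all of them at one and the same uniform variable produces nested
    random cubes.  They shrink to a random point, whose law is the measure.

    Closedness is proved on A, without measures.  The orbits of rho Phi and of rho' Phi
    are the same curves with different clocks: with Y the flow of rho' Phi, one has
    X (t, x) = Y (s, x) with |s - t| <= dl t, where dl bounds |rho / rho' - 1|
    (time_change).  If Y (n, x) / n tends to a for every x, all the limit points of
    X (n, x) / n are within dl sup |rho' Phi| of a (asymptotic_time_change).  When rho is
    a uniform limit of such rho', any two of its limit points are therefore equal.

    The flow itself is obtained by Picard's iteration on the whole real line (picard). *)

(** * Mean value estimates and Gronwall's inequality *)

Lemma rV_norm_le (R : realType) (d : nat) (x : 'rV[R]_d) (e : R) :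
  0 <= e -> (forall i, `|x 0 i| <= e) -> `|x| <= e.
Proof.
move=> e0 xe; rewrite /Num.Def.normr/= mx_normrE (bigmax_le _ e0)// => -[i j] _.
by rewrite /= ord1.
Qed.

Lemma coord_norm_le (R : realType) (d : nat) (x : 'rV[R]_d) i : `|x 0 i| <= `|x|.
Proof.
by rewrite [leRHS]/Num.Def.normr/= mx_normrE; apply: (le_bigmax _ _ (0, i)).
Qed.

Lemma geometric_small (R : realType) (C e : R) : 0 < e ->
  exists n : nat, C / 2 ^+ n < e.
Proof.
move=> e0.
have : (fun n => C * (2^-1) ^+ n) @ \oo --> C * 0.
  apply: cvgMr; apply: cvg_expr.
  by rewrite ger0_norm ?invr_ge0// invf_lt1 ?ltr1n.
rewrite mulr0 => /cvgrPdist_lt /(_ e e0)[n _ /(_ n)]/= => /(_ (leqnn _)) H.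
exists n; rewrite sub0r normrN exprVn in H.
exact: le_lt_trans (ler_norm _) H.
Qed.

Lemma le0_geometric (R : realType) (a A : R) :
  (forall n : nat, a <= A / 2 ^+ n) -> a <= 0.
Proof.
move=> H; apply/ler_addgt0Pr => e e0; rewrite add0r.
by have [n /ltW] := geometric_small A e0; exact: le_trans (H n).
Qed.

Lemma is_derive_rVP (R : realType) (d : nat) (f : R -> 'rV[R]_d) (t : R)
    (v : 'rV[R]_d) :
  is_derive t 1 f v <-> forall i, is_derive t 1 (fun s => f s 0 i) (v 0 i).
Proof.
split=> [[fd fv] i|fi].
  split; first by have /derivable_mxP := fd; exact.
  by rewrite -fv derive_mx// mxE.
have fd : derivable f t 1.
  by apply/derivable_mxP => i j; rewrite ord1; case: (fi j).
split=> //; rewrite derive_mx//; apply/rowP => j; rewrite !mxE.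
by case: (fi j).
Qed.

Lemma le_increment (R : realType) (f g df dg : R -> R) (a b : R) : a <= b ->
  (forall x : R, is_derive x 1 f (df x)) ->
  (forall x : R, is_derive x 1 g (dg x)) ->
  (forall x, a <= x <= b -> df x <= dg x) ->
  f b - f a <= g b - g a.
Proof.
move=> ab df_ dg_ le.
have D (x : R) : is_derive x 1 (g \- f) (dg x - df x) by exact: is_deriveB.
have C : {within `[a, b], continuous (g \- f)}.
  apply: continuous_subspaceT => x.
  by apply: differentiable_continuous; apply/derivable1_diffP; case: (D x).
have [x xab e] := MVT_segment ab (fun x _ => D x) C.
rewrite -subr_ge0; have -> : g b - g a - (f b - f a) = (g \- f) b - (g \- f) a.
  by rewrite /=; ring.
rewrite e mulr_ge0 ?subr_ge0// le//.
Qed.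

Lemma norm_increment_le (R : realType) (f g df dg : R -> R) (a b : R) : a <= b ->
  (forall x : R, is_derive x 1 f (df x)) ->
  (forall x : R, is_derive x 1 g (dg x)) ->
  (forall x, a <= x <= b -> `|df x| <= dg x) ->
  `|f b - f a| <= g b - g a.
Proof.
move=> ab Df Dg le; rewrite ler_norml; apply/andP; split; last first.
  apply: le_increment ab Df Dg _ => x /le; exact: le_trans (ler_norm _).
have DN (x : R) : is_derive x 1 (\- f) (- df x) by exact: is_deriveN.
rewrite lerNl (_ : - (f b - f a) = (\- f) b - (\- f) a); last by rewrite /=; ring.
apply: le_increment ab DN Dg _ => x /le; apply: le_trans.
by rewrite ler_normr lexx orbT.
Qed.

Lemma is_derive_mull (R : realType) (a x : R) : is_derive x 1 (fun s => a * s) a.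
Proof.
apply: (@is_derive_eq _ _ _ _ _ _ _ _ (@is_deriveZ R R R id a x 1 1 (is_derive_id _ _))).
by rewrite /GRing.scale/= mulr1.
Qed.

Lemma is_derive_expRZ (R : realType) (a K x : R) :
  is_derive x 1 (fun s => K * expR (a * s)) (K * (a * expR (a * x))).
Proof.
have h : is_derive x 1 (fun s => expR (a * s)) (a * expR (a * x)).
  rewrite mulrC; apply: (@is_derive1_comp _ expR (fun s => a * s)).
  exact: is_derive_mull.
exact: (@is_deriveZ R R R (fun s => expR (a * s)) K x 1 _ h).
Qed.

Lemma exp_growth_pos (R : realType) (f df : R -> R) (a K t : R) : 0 < a -> 0 <= t ->
  (forall s : R, is_derive s 1 f (df s)) ->
  (forall s, `|df s| <= K * expR (a * `|s|)) ->
  `|f t - f 0| <= K / a * (expR (a * t) - 1).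
Proof.
move=> a0 t0 Df le.
pose g s := K / a * expR (a * s).
have Dg (s : R) : is_derive s 1 g (K * expR (a * s)).
  by have := is_derive_expRZ a (K / a) s; rewrite mulrA divfK ?gt_eqF.
have Eg : g t - g 0 = K / a * (expR (a * t) - 1) by rewrite /g mulr0 expR0; ring.
rewrite -Eg; apply: norm_increment_le t0 Df Dg _ => x /andP[x0 _].
by have := le x; rewrite (ger0_norm x0).
Qed.

Lemma is_derive_reflect (R : realType) (f : R -> R) (df x : R) :
  is_derive (- x) 1 f df -> is_derive x 1 (fun s => f (- s)) (- df).
Proof.
move=> fx; have := @is_derive1_comp R f (fun s => - s) x df (- 1) fx (is_deriveNid x 1).
by rewrite mulrN1.
Qed.

Lemma exp_growth (R : realType) (f df : R -> R) (a K t : R) : 0 < a ->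
  (forall s : R, is_derive s 1 f (df s)) ->
  (forall s, `|df s| <= K * expR (a * `|s|)) ->
  `|f t - f 0| <= K / a * (expR (a * `|t|) - 1).
Proof.
move=> a0 Df le; have [t0|t0] := leP 0 t.
  by rewrite (ger0_norm t0); exact: (exp_growth_pos a0 t0 Df le).
have nt : 0 <= - t by rewrite oppr_ge0 ltW.
have := @exp_growth_pos R (fun s => f (- s)) (fun s => - df (- s)) a K (- t) a0 nt.
rewrite opprK oppr0 (ltr0_norm t0); apply => s.
  exact: is_derive_reflect.
by rewrite normrN (le_trans (le _))// normrN.
Qed.

(** With a weight exp (a |s|), integration gains a factor 1 / a.  Taking a = 2 L beats
    a Lipschitz constant L by a factor two over the whole real line at once; both
    Gronwall's inequality and the convergence of Picard's iteration rest on this. *)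
Lemma exp_growth_rV (R : realType) (d : nat) (f df : R -> 'rV[R]_d) (a K t : R) :
  0 < a -> 0 <= K ->
  (forall s : R, is_derive s 1 f (df s)) ->
  (forall s, `|df s| <= K * expR (a * `|s|)) ->
  `|f t - f 0| <= K / a * (expR (a * `|t|) - 1).
Proof.
move=> a0 K0 Df le; apply: rV_norm_le => [|i].
  rewrite mulr_ge0 ?divr_ge0 ?(ltW a0)// subr_ge0 -[leLHS]expR0 ler_expR.
  by rewrite mulr_ge0// ltW.
rewrite !mxE; apply: (@exp_growth R (fun s => f s 0 i) (fun s => df s 0 i)) => // s.
  by move: (Df s) => /is_derive_rVP.
by rewrite (le_trans (coord_norm_le _ _)).
Qed.

Lemma bounded_growth_on (R : realType) (d : nat) (f df : R -> 'rV[R]_d) (M a b : R) :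
  0 <= M -> a <= b -> (forall s : R, is_derive s 1 f (df s)) ->
  (forall s, a <= s <= b -> `|df s| <= M) ->
  `|f b - f a| <= M * (b - a).
Proof.
move=> M0 ab Df le.
apply: rV_norm_le => [|i]; first by rewrite mulr_ge0// subr_ge0.
pose g s : R := M * s.
have Dg (s : R) : is_derive s 1 g M by exact: is_derive_mull.
have D (s : R) : is_derive s 1 (fun s => f s 0 i) (df s 0 i).
  by move: (Df s) => /is_derive_rVP.
have -> : M * (b - a) = g b - g a by rewrite /g; ring.
rewrite !mxE; apply: norm_increment_le ab D Dg _ => s /le.
exact: le_trans (coord_norm_le _ _).
Qed.

Lemma bounded_growth (R : realType) (d : nat) (f df : R -> 'rV[R]_d) (M a b : R) :
  0 <= M -> (forall s : R, is_derive s 1 f (df s)) -> (forall s, `|df s| <= M) ->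
  `|f b - f a| <= M * `|b - a|.
Proof.
move=> M0 Df le; wlog ab : a b / a <= b => [H|].
  by have [/H//|/ltW/H] := leP a b; rewrite distrC (distrC b).
rewrite (ger0_norm (x := b - a)) ?subr_ge0//.
exact: bounded_growth_on M0 ab Df _.
Qed.

(** A bound (2 |f 0| + K) exp (2 L |t|) on |f t| improves itself to the same bound
    with K / 2.  The uniform bound M on the derivative serves to start from a finite
    K; iterating removes K altogether. *)
Lemma gronwall (R : realType) (d : nat) (f df : R -> 'rV[R]_d) (M L : R) :
  0 < L -> (forall s : R, is_derive s 1 f (df s)) ->
  (forall s, `|df s| <= M) -> (forall s, `|df s| <= L * `|f s|) ->
  forall t, `|f t| <= 2 * `|f 0| * expR (2 * L * `|t|).
Proof.
move=> L0 Df dfM dfL.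
have M0 : 0 <= M by exact: le_trans (dfM 0).
pose D0 := `|f 0|; have D0ge : 0 <= D0 by exact: normr_ge0.
have E1 (t : R) : 1 <= expR (2 * L * `|t|).
  by rewrite -[leLHS]expR0 ler_expR !mulr_ge0// ltW.
(* integrating the bound on df halves the excess K, because the rate 2 L
   is twice the Lipschitz constant *)
have step (K : R) : 0 <= K -> (forall t, `|f t| <= (2 * D0 + K) * expR (2 * L * `|t|)) ->
    forall t, `|f t| <= (2 * D0 + K / 2) * expR (2 * L * `|t|).
  move=> K0 H t.
  have Hg : `|f t - f 0| <= (D0 + K / 2) * (expR (2 * L * `|t|) - 1).
    have -> : D0 + K / 2 = L * (2 * D0 + K) / (2 * L) by field; rewrite gt_eqF.
    apply: exp_growth_rV Df _; first by rewrite mulr_gt0.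
      by rewrite mulr_ge0 ?(ltW L0)// addr_ge0 ?mulr_ge0 // normr_ge0.
    by move=> s; rewrite (le_trans (dfL s))// -mulrA ler_wpM2l// ltW.
  rewrite -[f t](subrK (f 0)) (le_trans (ler_normD _ _))//.
  have : 0 <= D0 * expR (2 * L * `|t|) by rewrite mulr_ge0// expR_ge0.
  move: Hg; rewrite -/D0; set E := expR _; set F := `|f t - f 0|.
  lra.
have Kn n : forall t, `|f t| <= (2 * D0 + M / L / 2 ^+ n) * expR (2 * L * `|t|).
  elim: n => [|n IH].
    move=> t; rewrite expr0 divr1.
    have := @bounded_growth R d f df M 0 t M0 Df dfM; rewrite subr0 => H.
    rewrite -[f t](subrK (f 0)) (le_trans (ler_normD _ _))// -/D0.
    have HE : L * `|t| <= expR (2 * L * `|t|).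
      apply: le_trans (expR_ge1Dx _); have : 0 <= L * `|t| by rewrite mulr_ge0// ltW.
      lra.
    have : M * `|t| <= M / L * expR (2 * L * `|t|).
      by rewrite -mulrA ler_wpM2l// mulrC ler_pdivlMr// mulrC.
    have : D0 <= D0 * expR (2 * L * `|t|) by rewrite ler_peMr.
    move: H; set E := expR _; set F := `|f t - f 0|; lra.
  have := step _ _ IH; rewrite exprSr invfM mulrA; apply.
  by rewrite !divr_ge0// ?(ltW L0)// exprn_ge0.
move=> t; rewrite -/D0 -subr_le0.
apply: (@le0_geometric _ _ (M / L * expR (2 * L * `|t|))) => n.
by rewrite lerBlDl (le_trans (Kn n t))// mulrDl lerD2l mulrAC.
Qed.

(** * Primitives of continuous functions *)

(** One of the two intervals is empty or reduced to a point, so that this is the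
    oriented integral from 0 to t. *)
Definition primitive (R : realType) (g : R -> R) (t : R) : R :=
  \int[lebesgue_measure]_(s in `[0, t]) g s -
  \int[lebesgue_measure]_(s in `[t, 0]) g s.

Lemma primitive0 (R : realType) (g : R -> R) : primitive g 0 = 0.
Proof. by rewrite /primitive subrr. Qed.

(** The fundamental theorem of calculus applies to integrals with a fixed left end;
    locally in t, the base point 0 can be moved far enough to the left. *)
Lemma primitiveE (R : realType) (g : R -> R) (a t : R) : continuous g ->
  a <= 0 -> a <= t ->
  primitive g t = \int[lebesgue_measure]_(s in `[a, t]) g s -
                  \int[lebesgue_measure]_(s in `[a, 0]) g s.
Proof.
move=> cg a0 at_.
have ig (x y : R) : lebesgue_measure.-integrable `[x, y] (EFin \o g).
  apply: continuous_compact_integrable; first exact: segment_compact.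
  exact: continuous_subspaceT.
have split (x y z : R) : x <= y -> y <= z ->
    \int[lebesgue_measure]_(s in `[x, z]) g s -
    \int[lebesgue_measure]_(s in `[x, y]) g s =
    \int[lebesgue_measure]_(s in `[y, z]) g s.
  move=> xy yz; rewrite Rintegral_itvB ?bnd_simp//.
  rewrite Rintegral_itv_obnd_cbnd//.
  by apply: integrableS (ig y z) => //; exact: subset_itv_oc_cc.
have null (x y : R) : x <= y -> \int[lebesgue_measure]_(s in `[y, x]) g s = 0.
  rewrite le_eqVlt => /predU1P[->|xy]; first by rewrite set_itv1 Rintegral_set1.
  by rewrite set_itv_ge ?Rintegral_set0// bnd_simp -ltNge.
rewrite /primitive; have [t0|/ltW t0] := leP 0 t.
  by rewrite (split a 0 t a0 t0) (null 0 t t0) subr0.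
by rewrite (null t 0 t0) sub0r -(split a t 0 at_ t0) opprB.
Qed.

Lemma is_derive_primitive (R : realType) (g : R -> R) (t : R) : continuous g ->
  is_derive t 1 (primitive g) (g t).
Proof.
move=> cg; pose a : R := - (`|t| + 1).
have a0 : a < 0 by rewrite oppr_lt0 ltr_wpDl.
have at_ : a < t by rewrite /a ltrNl; have := ler_norm (- t); rewrite normrN; lra.
pose F s := \int[lebesgue_measure]_(x in `[a, s]) g x.
have tt1 : t < t + 1 by rewrite ltrDl.
have [dF eF] : derivable F t 1 /\ derive1 F t = g t.
  apply: (continuous_FTC1_closed tt1) => //; last exact: cg.
  apply: continuous_compact_integrable; first exact: segment_compact.
  exact: continuous_subspaceT.
apply: (@near_eq_is_derive _ _ _ (F \- cst (F 0))).
  near=> s; rewrite (@primitiveE _ _ a)// ?(ltW a0)// ltW//.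
  by near: s; exact: lt_nbhsr.
rewrite -[g t]subr0; apply: is_deriveB.
by split => //; rewrite -derive1E.
Unshelve. all: by end_near. Qed.

(** * Periodic functions *)

(** The representative in [0,1)^d of the class of y modulo Z^d. *)
Definition frac (R : realType) (d : nat) (y : 'rV[R]_d) : 'rV[R]_d :=
  y + map_mx intr (\row_i - Num.floor (y 0 i)).

Lemma fracE (R : realType) (d : nat) (y : 'rV[R]_d) i :
  frac y 0 i = y 0 i - (Num.floor (y 0 i))%:~R.
Proof. by rewrite /frac !mxE intrN. Qed.

Lemma frac_torus (R : realType) (d : nat) (y : 'rV[R]_d) : torus R d (frac y).
Proof.
move=> i; rewrite fracE subr_ge0 ltrBlDr addrC.
have /andP[-> /=] := floor_itv (y 0 i).
by rewrite intrD.
Qed.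

Lemma periodic_frac (R : realType) (d : nat) (T : Type) (f : 'rV[R]_d -> T) y :
  periodic f -> f (frac y) = f y.
Proof. by move=> pf; rewrite /frac pf. Qed.

Lemma compact_cube (R : realType) (d : nat) :
  compact [set v : 'rV[R]_d | forall i, 0 <= v 0 i <= 1].
Proof.
have := @rV_compact R d (fun _ => `[0, 1]%classic) (fun _ => @segment_compact R 0 1).
by congr compact; apply/seteqP; split=> v /= vP i; have := vP i; rewrite in_itv.
Qed.

Lemma frac_cube (R : realType) (d : nat) (y : 'rV[R]_d) i : 0 <= frac y 0 i <= 1.
Proof. by have /andP[-> /ltW] := frac_torus y i. Qed.

Lemma C0_sharp_bounded (R : realType) (d : nat) (f : 'rV[R]_d -> R) :
  C0_sharp R d f -> exists2 M : R, 0 < M & forall x, `|f x| <= M.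
Proof.
move=> [cf pf].
have [M [_ HM]] := compact_bounded (continuous_compact (continuous_subspaceT cf)
  (@compact_cube R d)).
 exists (`|M| + 1); first by rewrite ltr_wpDl.
move=> x; rewrite -(periodic_frac x pf); apply: HM.
  by rewrite (le_lt_trans (ler_norm M))// ltrDl.
by exists (frac x) => //= i; exact: frac_cube.
Qed.

(** Heine's theorem on the unit cube; translating by an integer vector brings x, but
    not y, into the cube. *)
Lemma C0_sharp_unif_continuous (R : realType) (d : nat) (f : 'rV[R]_d -> R) (e : R) :
  C0_sharp R d f -> 0 < e ->
  exists2 dl : R, 0 < dl & forall x y, `|x - y| < dl -> `|f x - f y| < e.
Proof.
move=> [cf pf] e0.
have /compact_near_coveringP /(_ R (0 : R)^'+
  (fun r x => forall y, `|x - y| < r -> `|f x - f y| < e) _) H := @compact_cube R d.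
have {}H : \forall r \near 0^'+, forall x : 'rV[R]_d, (forall i, 0 <= x 0 i <= 1) ->
    forall y, `|x - y| < r -> `|f x - f y| < e.
  apply: H => x _.
  have e2 : 0 < e / 2 by rewrite divr_gt0.
  have /cvgrPdist_lt /(_ _ e2) /nbhs_ballP[r /= r0 Hr] := cf x.
  have r2 : 0 < r / 2 by rewrite divr_gt0.
  (* radius and point are covered together, so that y may leave the cube *)
  exists (ball x (r / 2), [set s | s < r / 2]).
    by split; [exact: nbhsx_ballx|exact: nbhs_right_lt].
  move=> [x' s] /= [xx' sr] y x'y.
  rewrite -ball_normE /= in xx'.
  have h1 : `|f x - f x'| < e / 2.
    apply: Hr; rewrite -ball_normE /=; lra.
  have h2 : `|f x - f y| < e / 2.
    apply: Hr; rewrite -ball_normE /=.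
    by rewrite (le_lt_trans (ler_distD x' _ _))// (splitr r) ltrD// (lt_trans x'y).
  by rewrite (le_lt_trans (ler_distD (f x) _ _))// (splitr e) ltrD// distrC.
have [r [r0 Hr]] : exists r : R, 0 < r /\
    forall x : 'rV[R]_d, (forall i, 0 <= x 0 i <= 1) ->
    forall y, `|x - y| < r -> `|f x - f y| < e.
  apply: (@filter_ex _ (0 : R)^'+); apply: filterI H; exact: nbhs_right_gt.
exists r => // x y xy.
pose k : 'rV[int]_d := \row_i - Num.floor (x 0 i).
rewrite -(pf x k) -(pf y k); apply: Hr; first by move=> i; exact: frac_cube.
by rewrite opprD addrACA subrr addr0.
Qed.

(** The two derivatives are limits of the same difference quotient. *)
Lemma is_derive_line (R : realType) (d : nat) (f : 'rV[R]_d -> R) x v (s : R) :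
  derivable f (x + s *: v) v ->
  is_derive s 1 (fun s => f (x + s *: v)) ('D_v f (x + s *: v)).
Proof.
have E : (fun h : R => h^-1 *: (((fun s => f (x + s *: v)) \o shift s) (h *: 1) -
      f (x + s *: v))) =
    (fun h : R => h^-1 *: ((f \o shift (x + s *: v)) (h *: v) - f (x + s *: v))).
  apply/funext => h /=; congr (_ *: (f _ - _)).
  by rewrite scalerDl addrCA [h *: 1]mulr1.
by move=> df; split; rewrite ?/derivable ?/derive E.
Qed.

Lemma periodic_derive (R : realType) (d : nat) (f : 'rV[R]_d -> R) v :
  periodic f -> periodic (fun x => 'D_v f x).
Proof.
move=> pf x k; rewrite /derive.
have -> // : (fun h : R => h^-1 *: ((f \o shift (x + map_mx intr k)) (h *: v) -
      f (x + map_mx intr k))) =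
    (fun h : R => h^-1 *: ((f \o shift x) (h *: v) - f x)).
by apply/funext => h /=; rewrite addrA !pf.
Qed.

Lemma C1_sharp_C0 (R : realType) (d : nat) : C1_sharp R d `<=` C0_sharp R d.
Proof.
by move=> f [df _ pf]; split=> // x; exact: differentiable_continuous.
Qed.

(** The partial derivatives are continuous and periodic, hence bounded; by linearity
    in v they bound 'D_v f, and the mean value theorem on a segment concludes. *)
Lemma C1_sharp_lipschitz (R : realType) (d : nat) (f : 'rV[R]_d -> R) :
  C1_sharp R d f -> exists2 L : R, 0 < L & forall x y, `|f x - f y| <= L * `|x - y|.
Proof.
move=> [df cf pf].
have bd i : {L : R | 0 < L & forall x, `|'D_(delta_mx 0 i) f x| <= L}.
  apply: cid2; apply: C0_sharp_bounded; split; first exact: cf.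
  exact: periodic_derive.
pose L := \sum_i (s2val (bd i)) + 1.
have sL0 : 0 <= \sum_i (s2val (bd i)).
  by apply: sumr_ge0 => i _; rewrite ltW// (s2valP (bd i)).
have L0 : 0 < L by rewrite ltr_wpDl.
exists L => // x y; pose v : 'rV[R]_d := x - y.
have D (s : R) : is_derive s 1 (fun s => f (y + s *: v)) ('D_v f (y + s *: v)).
  by apply: is_derive_line; apply: diff_derivable; exact: df.
have bD z : `|'D_v f z| <= L * `|v|.
  rewrite deriveE//; rewrite {1}(row_sum_delta v) linear_sum /=.
  rewrite (le_trans (ler_norm_sum _ _ _))// mulrDl mul1r mulr_suml.
  rewrite (@le_trans _ _ (\sum_i s2val (bd i) * `|v|)) ?lerDl//.
  apply: ler_sum => i _; rewrite linearZ /= normrM mulrC ler_pM//.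
    by rewrite -deriveE// (s2valP' (bd i)).
  exact: coord_norm_le.
have C : {within `[0, 1], continuous (fun s => f (y + s *: v))}.
  apply: continuous_subspaceT => s.
  by apply: differentiable_continuous; apply/derivable1_diffP; case: (D s).
have [c _] := MVT_segment ler01 (fun s _ => D s) C.
rewrite scale1r scale0r addr0 [y + v]addrC /v subrK => ->.
by rewrite subr0 mulr1.
Qed.

(** * The Cauchy-Lipschitz theorem *)

Lemma geometric_cauchy (R : realType) (d : nat) (z : nat -> 'rV[R]_d) (C : R) :
  (forall n, `|z n.+1 - z n| <= C / 2 ^+ n) ->
  exists l, forall n, `|l - z n| <= 2 * C / 2 ^+ n.
Proof.
move=> H.
have C0 : 0 <= C by have := H 0%N; rewrite expr0 divr1; apply: le_trans.
have tail n k : `|z (n + k)%N - z n| <= 2 * C / 2 ^+ n - 2 * C / 2 ^+ (n + k).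
  elim: k => [|k IH]; first by rewrite addn0 !subrr normr0.
  rewrite addnS (le_trans (ler_distD (z (n + k)%N) _ _))//.
  have -> : 2 * C / 2 ^+ n - 2 * C / 2 ^+ (n + k).+1 =
      C / 2 ^+ (n + k) + (2 * C / 2 ^+ n - 2 * C / 2 ^+ (n + k)).
    by rewrite exprS; field; rewrite !expf_neq0.
  exact: lerD.
have tail' n m : (n <= m)%N -> `|z m - z n| <= 2 * C / 2 ^+ n.
  move=> /subnKC <-; apply: le_trans (tail _ _) _.
  by rewrite lerBlDr lerDl !mulr_ge0// invr_ge0 exprn_ge0.
have : cvg (z @ \oo).
  apply: cauchy_cvg; apply: cauchy_exP => e e0.
  have [n ne] := geometric_small (2 * C) e0.
  exists (z n), n => // m /= nm; rewrite -ball_normE /=.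
  by rewrite distrC (le_lt_trans (tail' _ _ nm)).
move=> /cvg_ex[l zl]; exists l => n; apply/ler_addgt0Pl => e e0.
move/cvgrPdist_lt : zl => /(_ e e0)[m _ Hm].
rewrite (le_trans (ler_distD (z (maxn m n)) _ _))//.
rewrite lerD ?tail' ?leq_maxr// ltW//; apply: Hm; exact: leq_maxl.
Qed.

(** The regularity of a C^1 periodic field enters only through these three properties,
    which ensure a global flow that is continuous and commutes with integer
    translations. *)
Definition lipschitz_field (R : realType) (d : nat) (b : 'rV[R]_d -> 'rV[R]_d) :=
  [/\ periodic b, exists2 M : R, 0 < M & forall x, `|b x| <= M
    & exists2 L : R, 0 < L & forall x y, `|b x - b y| <= L * `|x - y|].

Definition is_solution (R : realType) (d : nat) (b : 'rV[R]_d -> 'rV[R]_d)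
    (f : R -> 'rV[R]_d) := forall s : R, is_derive s 1 f (b (f s)).

Definition primitive_rV (R : realType) (d : nat) (x : 'rV[R]_d) (g : R -> 'rV[R]_d)
    (t : R) : 'rV[R]_d := x + \row_i primitive (fun s => g s 0 i) t.

Lemma primitive_rV0 (R : realType) (d : nat) (x : 'rV[R]_d) g : primitive_rV x g 0 = x.
Proof. by apply/rowP => i; rewrite !mxE primitive0 addr0. Qed.

Lemma is_derive_primitive_rV (R : realType) (d : nat) (x : 'rV[R]_d)
    (g : R -> 'rV[R]_d) (t : R) : continuous g ->
  is_derive t 1 (primitive_rV x g) (g t).
Proof.
move=> cg; apply/is_derive_rVP => i.
have cgi : continuous (fun s => g s 0 i).
  move=> s; apply: (@continuous_comp _ _ _ g (fun N : 'rV[R]_d => N 0 i)).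
    exact: cg.
  exact: coord_continuous.
have -> : (fun s => primitive_rV x g s 0 i) =
    cst (x 0 i) \+ primitive (fun s => g s 0 i).
  by apply/funext => s; rewrite !mxE.
rewrite -[g t 0 i]add0r; apply: is_deriveD.
exact: (is_derive_primitive t cgi).
Qed.

Lemma lipschitz_continuous (R : realType) (V W : normedModType R) (L : R) (f : V -> W) :
  0 < L -> (forall x y, `|f x - f y| <= L * `|x - y|) -> continuous f.
Proof.
move=> L0 Lf x; apply/cvgrPdist_lt => e e0; apply/nbhs_ballP.
exists (e / L) => /=; first by rewrite divr_gt0.
move=> y; rewrite -ball_normE /= => xy; rewrite (le_lt_trans (Lf _ _))//.
by rewrite mulrC -ltr_pdivlMr.
Qed.

Section picard.
Variables (R : realType) (d : nat) (b : 'rV[R]_d -> 'rV[R]_d) (M L : R).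
Hypotheses (M0 : 0 < M) (bM : forall x, `|b x| <= M).
Hypotheses (L0 : 0 < L) (bL : forall x y, `|b x - b y| <= L * `|x - y|).

(** Picard's iteration converges on the whole line: consecutive iterates differ by at
    most C 2^-n exp (2 L |t|), since each integration gains a factor 1 / (2 L) against
    the Lipschitz constant L. *)
Lemma picard : forall x0, exists f : R -> 'rV[R]_d, f 0 = x0 /\ is_solution b f.
Proof.
move=> x0.
pose u := fix u n : R -> 'rV[R]_d :=
  if n is n'.+1 then primitive_rV x0 (b \o u n') else cst x0.
have u0 n : u n 0 = x0 by case: n => [|n] //=; rewrite primitive_rV0.
have cb : continuous b by exact: lipschitz_continuous bL.
have speed (g : R -> 'rV[R]_d) (s t : R) : continuous g ->
    `|primitive_rV x0 (b \o g) t - primitive_rV x0 (b \o g) s| <= M * `|t - s|.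
  move=> cg; apply: (@bounded_growth _ _ _ (b \o g)); first exact: ltW.
    move=> r; apply: is_derive_primitive_rV => z.
    by apply: continuous_comp; [exact: cg|exact: cb].
  by move=> r /=.
have cu n : continuous (u n).
  elim: n => [|n IH] /=; first exact: cst_continuous.
  by apply: lipschitz_continuous M0 _ => s t; exact: speed.
have cbu n : continuous (b \o u n).
  by move=> z; apply: continuous_comp; [exact: cu|exact: cb].
have du n (s : R) : is_derive s 1 (u n.+1) (b (u n s)).
  exact: is_derive_primitive_rV.
pose E (t : R) : R := expR (2 * L * `|t|).
have E1 t : 1 <= E t by rewrite -[leLHS]expR0 ler_expR !mulr_ge0// ltW.
pose C := M / L.
have C0 : 0 < C by rewrite divr_gt0.
have grow (f df : R -> 'rV[R]_d) (K t : R) : f 0 = 0 -> 0 <= K ->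
    (forall s : R, is_derive s 1 f (df s)) ->
    (forall s, `|df s| <= L * K * E s) -> `|f t| <= K / 2 * E t.
  move=> f0 K0 Df le.
  have := @exp_growth_rV _ _ f df (2 * L) (L * K) t (mulr_gt0 (ltr0Sn _ 1) L0)
    (mulr_ge0 (ltW L0) K0) Df le.
  rewrite f0 subr0 => H; apply: le_trans H _.
  have -> : L * K / (2 * L) = K / 2 by field; rewrite gt_eqF.
  by rewrite ler_wpM2l ?divr_ge0// lerBlDr lerDl.
have step n t : `|u n.+1 t - u n t| <= C * E t / 2 ^+ n.
  elim: n t => [|n IH] t.
    rewrite expr0 divr1.
    have : `|u 1%N t - u 1%N 0| <= M * `|t - 0| by exact: speed (cu 0%N).
    rewrite subr0 u0 /= => /le_trans; apply.
    have HE : L * `|t| <= E t.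
      apply: le_trans (expR_ge1Dx _); have : 0 <= L * `|t| by rewrite mulr_ge0// ltW.
      lra.
    by rewrite /C -mulrA ler_wpM2l ?(ltW M0)// mulrC ler_pdivlMr// mulrC.
  have f0 : u n.+2 0 - u n.+1 0 = 0 by rewrite (u0 n.+2) (u0 n.+1) subrr.
  have H := grow (u n.+2 \- u n.+1) (fun s => b (u n.+1 s) - b (u n s)) (C / 2 ^+ n) t f0.
  have -> : C * E t / 2 ^+ n.+1 = C / 2 ^+ n / 2 * E t.
    by rewrite exprS; field; rewrite expf_neq0.
  apply: H; first by rewrite divr_ge0 ?exprn_ge0// ltW.
  move=> s; rewrite (le_trans (bL _ _))// -mulrA ler_wpM2l ?(ltW L0)//.
  by rewrite (le_trans (IH s))// mulrAC.
have /choice[v vu] : forall t, exists l, forall n, `|l - u n t| <= 2 * (C * E t) / 2 ^+ n.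
  by move=> t; apply: geometric_cauchy => n; exact: step.
have vlip s t : `|v s - v t| <= M * `|s - t|.
  rewrite -subr_le0; apply: (@le0_geometric _ _ (2 * (C * E s) + 2 * (C * E t))) => n.
  have half r : `|v r - u n.+1 r| <= 2 * (C * E r) / 2 ^+ n.
    apply: le_trans (vu r n.+1) _; apply: ler_wpM2l.
      by rewrite mulr_ge0// mulr_ge0 ?(ltW C0)// (le_trans _ (E1 r)).
    by rewrite lef_pV2 ?posrE ?exprn_gt0// ler_weXn2l// ler1n.
  rewrite lerBlDr mulrDl -addrA; apply: le_trans (ler_distD (u n.+1 s) _ _) _.
  apply: lerD (half s) _; rewrite addrC.
  apply: le_trans (ler_distD (u n.+1 t) _ _) _.
  by apply: lerD (speed _ _ _ (cu n)) _; rewrite distrC.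
have cv : continuous v by exact: lipschitz_continuous vlip.
have cbv : continuous (b \o v).
  by move=> z; apply: continuous_comp; [exact: cv|exact: cb].
pose w := primitive_rV x0 (b \o v).
have dw (s : R) : is_derive s 1 w (b (v s)) by exact: is_derive_primitive_rV.
(* w and v are both at distance O(2^-n) from u n.+1, so the limit v is a fixed
   point of the integral equation *)
have wv : w = v.
  apply/funext => t; apply/eqP; rewrite -subr_eq0 -normr_le0.
  apply: (@le0_geometric _ _ (2 * (C * E t))) => n.
  rewrite (le_trans (ler_distD (u n.+1 t) _ _))//.
  have H1 : `|w t - u n.+1 t| <= C / 2 ^+ n * E t.
    have f0 : w 0 - u n.+1 0 = 0 by rewrite (u0 n.+1) /w primitive_rV0 subrr.
    have H := grow (w \- u n.+1) (fun s => b (v s) - b (u n s)) (2 * C / 2 ^+ n) t f0.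
    have -> : C / 2 ^+ n * E t = 2 * C / 2 ^+ n / 2 * E t.
      by field; rewrite expf_neq0.
    apply: H; first by rewrite divr_ge0 ?exprn_ge0// mulr_ge0// ltW.
    move=> s; rewrite (le_trans (bL _ _))// -mulrA ler_wpM2l ?(ltW L0)//.
    by rewrite (le_trans (vu s n))// mulrA mulrAC.
  have := vu t n.+1; rewrite exprS.
  have -> : 2 * (C * E t) / (2 * 2 ^+ n) = C / 2 ^+ n * E t.
    by field; rewrite expf_neq0.
  have -> : 2 * (C * E t) / 2 ^+ n = C / 2 ^+ n * E t + C / 2 ^+ n * E t.
    by field; rewrite expf_neq0.
  by move=> H2; rewrite lerD// distrC.
exists w; split; first by rewrite /w primitive_rV0.
by move=> s; rewrite [X in b (X s)]wv.
Qed.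

End picard.

(** * The flow of a periodic Lipschitz field *)

Lemma C1_sharp_bounded_lipschitz (R : realType) (d : nat) (f : 'rV[R]_d -> R) :
  C1_sharp R d f -> exists A : R, [/\ 0 < A, forall x, `|f x| <= A &
    forall x y, `|f x - f y| <= A * `|x - y|].
Proof.
move=> Cf; have [M M0 fM] := C0_sharp_bounded (C1_sharp_C0 Cf).
have [L L0 fL] := C1_sharp_lipschitz Cf.
exists (M + L); split; first exact: addr_gt0.
  by move=> x; rewrite (le_trans (fM x))// lerDl ltW.
by move=> x y; rewrite (le_trans (fL x y))// ler_wpM2r// lerDr ltW.
Qed.

Lemma scale_field_lipschitz (R : realType) (d : nat) (rho : 'rV[R]_d -> R)
    (Phi : 'rV[R]_d -> 'rV[R]_d) :
  C1_sharp R d rho -> C1_sharp_field Phi -> lipschitz_field (scale_field rho Phi).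
Proof.
move=> Crho CPhi; have [A [A0 rA rL]] := C1_sharp_bounded_lipschitz Crho.
have /choice[B HB] := fun i => C1_sharp_bounded_lipschitz (CPhi i).
pose C := \sum_i B i + 1.
have B0 i : 0 <= B i by apply: ltW; case: (HB i).
have BC i : B i <= C.
  by rewrite /C (bigD1 i)//= -addrA lerDl addr_ge0// sumr_ge0.
have C0 : 0 < C by rewrite ltr_wpDl// sumr_ge0.
have PC x i : `|Phi x 0 i| <= C.
  by case: (HB i) => _ H _; exact: le_trans (H x) (BC i).
have PL x y i : `|Phi x 0 i - Phi y 0 i| <= C * `|x - y|.
  case: (HB i) => _ _ H; apply: le_trans (H x y) _.
  by rewrite ler_wpM2r.
split.
- move=> x k; rewrite /scale_field; congr (_ *: _).
    by case: Crho => _ _ ->.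
  by apply/rowP => i; case: (CPhi i) => _ _ /(_ x k).
- exists (A * C); first exact: mulr_gt0.
  move=> x; apply: rV_norm_le => [|i]; first by rewrite mulr_ge0// ltW.
  by rewrite mxE normrM ler_pM.
- exists (A * C + A * C); first by rewrite addr_gt0// mulr_gt0.
  move=> x y; apply: rV_norm_le => [|i].
    by rewrite mulr_ge0// addr_ge0// mulr_ge0// ltW.
  rewrite !mxE.
  have -> : rho x * Phi x 0 i - rho y * Phi y 0 i =
    rho x * (Phi x 0 i - Phi y 0 i) + (rho x - rho y) * Phi y 0 i by ring.
  apply: (le_trans (ler_normD _ _)); rewrite [leRHS]mulrDl !normrM; apply: lerD.
    by rewrite -mulrA ler_pM.
  by rewrite mulrAC ler_pM.
Qed.

Section flow.
Variables (R : realType) (d : nat) (b : 'rV[R]_d -> 'rV[R]_d).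
Hypothesis hb : lipschitz_field b.

Lemma flow_is_flow : is_flow b (flow b).
Proof.
case: hb => _ [M M0 bM] [L L0 bL].
have /choice[X XP] := picard M0 bM L0 bL.
apply: (@xgetPex _ _ [set X | is_flow b X]).
by exists (fun t x => X x t) => x; case: (XP x).
Qed.

Lemma flow0 x : flow b 0 x = x.
Proof. by case: (flow_is_flow x). Qed.

Lemma flow_solution x : is_solution b (fun t => flow b t x).
Proof. by case: (flow_is_flow x). Qed.

Lemma solution_dist (f g : R -> 'rV[R]_d) (L : R) : 0 < L ->
  (forall x y, `|b x - b y| <= L * `|x - y|) ->
  is_solution b f -> is_solution b g ->
  forall t, `|f t - g t| <= 2 * `|f 0 - g 0| * expR (2 * L * `|t|).
Proof.
case: hb => _ [M M0 bM] _ L0 bL sf sg.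
apply: (@gronwall _ _ (f \- g) (fun s => b (f s) - b (g s)) (M + M)) => //.
  by move=> s; exact: (is_deriveB (sf s) (sg s)).
by move=> s; rewrite (le_trans (ler_normB _ _))// lerD.
Qed.

Lemma solution_unique (f g : R -> 'rV[R]_d) :
  is_solution b f -> is_solution b g -> f 0 = g 0 -> f =1 g.
Proof.
case: (hb) => _ _ [L L0 bL] sf sg fg t.
have := solution_dist L0 bL sf sg t.
by rewrite fg subrr normr0 mulr0 mul0r normr_le0 subr_eq0 => /eqP.
Qed.

Lemma is_solution_shift (f : R -> 'rV[R]_d) (s : R) :
  is_solution b f -> is_solution b (fun t => f (t + s)).
Proof.
move=> sf t; apply/is_derive_rVP => i.
have /is_derive_rVP/(_ i) D := sf (t + s).
have := @is_derive1_comp _ (fun t => f t 0 i) (shift s) t _ _ D (is_derive_shift _ _ _).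
by rewrite mulr1.
Qed.

Lemma flowD t s x : flow b (t + s) x = flow b t (flow b s x).
Proof.
apply: (solution_unique (f := fun t => flow b (t + s) x)
  (g := fun t => flow b t (flow b s x))).
- exact: (is_solution_shift s (flow_solution x)).
- exact: flow_solution.
- by rewrite add0r flow0.
Qed.

Lemma flow_translate t x (k : 'rV[int]_d) :
  flow b t (x + map_mx intr k) = flow b t x + map_mx intr k.
Proof.
apply: (solution_unique (f := fun t => flow b t (x + map_mx intr k))
  (g := fun t => flow b t x + map_mx intr k)).
- exact: flow_solution.
- case: hb => pb _ _ s; rewrite pb -[b _]addr0.
  by apply: is_deriveD; exact: flow_solution.
- by rewrite !flow0.
Qed.

Lemma flow_speed M x s t : (forall x, `|b x| <= M) ->
  `|flow b t x - flow b s x| <= M * `|t - s|.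
Proof.
move=> bM; have M0 : 0 <= M by exact: le_trans (bM 0).
by apply: (bounded_growth s t M0 (flow_solution x)) => r.
Qed.

Lemma flow_continuous t : continuous (flow b t).
Proof.
case: (hb) => _ _ [L L0 bL].
apply: (@lipschitz_continuous _ _ _ (2 * expR (2 * L * `|t|))).
  by rewrite mulr_gt0// expR_gt0.
move=> x y; have := solution_dist L0 bL (flow_solution x) (flow_solution y) t.
by rewrite !flow0 mulrAC.
Qed.

Lemma C0_sharp_flow (psi : 'rV[R]_d -> R) t :
  C0_sharp R d psi -> C0_sharp R d (psi \o flow b t).
Proof.
move=> [cpsi ppsi]; split=> [x|x k /=].
  by apply: continuous_comp; [exact: flow_continuous|exact: cpsi].
by rewrite flow_translate ppsi.
Qed.

Lemma C0_sharp_field i : C0_sharp R d (fun x => b x 0 i).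
Proof.
case: hb => pb _ [L L0 bL]; split=> [x|x k]; last by rewrite pb.
apply: (@continuous_comp _ _ _ b (fun N : 'rV[R]_d => N 0 i)).
  exact: (lipschitz_continuous L0 bL).
exact: coord_continuous.
Qed.

Lemma C0_sharp_displacement t i : C0_sharp R d (fun x => (flow b t x - x) 0 i).
Proof.
split=> [x|x k]; last first.
  by rewrite flow_translate opprD addrACA subrr addr0.
apply: (@continuous_comp _ _ _ (fun x => flow b t x - x) (fun N : 'rV[R]_d => N 0 i)).
  exact: (cvgB (@flow_continuous t x) cvg_id).
exact: coord_continuous.
Qed.

(** The derivative of the left-hand side is b (X (s, x)) - b x, which is at most L M s
    because the orbit has speed at most M. *)
Lemma displacement_field (M L h : R) x : 0 <= h ->
  (forall x, `|b x| <= M) -> 0 < L -> (forall x y, `|b x - b y| <= L * `|x - y|) ->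
  `|flow b h x - x - h *: b x| <= L * M * h * h.
Proof.
move=> h0 bM L0 bL.
have M0 : 0 <= M by exact: le_trans (bM 0).
pose f t := flow b t x - t *: b x.
have -> : flow b h x - x - h *: b x = f h - f 0.
  by rewrite /f flow0 scale0r subr0 addrAC.
rewrite -[X in _ * X](subr0 h).
apply: (@bounded_growth_on _ _ f (fun s => b (flow b s x) - b x)) => //.
- by rewrite !mulr_ge0// ltW.
- move=> s; apply: is_deriveB; first exact: flow_solution.
  apply/is_derive_rVP => i.
  have -> : (fun s : R => (s *: b x) 0 i) = (fun s => b x 0 i * s).
    by apply/funext => r; rewrite mxE mulrC.
  exact: is_derive_mull.
move=> s /andP[s0 sh]; rewrite (le_trans (bL _ _))// -!mulrA ler_wpM2l ?(ltW L0)//.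
rewrite -{2}(flow0 x) (le_trans (flow_speed _ _ _ bM))// subr0 ler_wpM2l// ger0_norm//.
Qed.

End flow.

(** * Integration against a probability *)

Section bounded_integrals.
Context d (T : measurableType d) (R : realType) (P : probability T R).

Lemma bounded_integrable (D : set T) (f : T -> R) (M : R) : measurable D ->
  measurable_fun D f -> (forall x, D x -> `|f x| <= M) -> P.-integrable D (EFin \o f).
Proof.
move=> mD mf fM; apply: measurable_bounded_integrable => //.
  by rewrite (le_lt_trans (probability_le1 P mD))// ltry.
exists M; split; first exact: num_real.
by move=> y My x Dx; exact: le_trans (fM x Dx) (ltW My).
Qed.

Lemma Rintegral_close (f g : T -> R) (M e : R) :
  measurable_fun setT f -> measurable_fun setT g ->
  (forall x, `|f x| <= M) -> (forall x, `|g x| <= M) ->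
  (forall x, `|f x - g x| <= e) ->
  `|\int[P]_x f x - \int[P]_x g x| <= e.
Proof.
move=> mf mg fM gM fg.
have e0 : 0 <= e by exact: le_trans (fg point).
have inf : P.-integrable setT (EFin \o f) by exact: bounded_integrable (fun x _ => fM x).
have ing : P.-integrable setT (EFin \o g) by exact: bounded_integrable (fun x _ => gM x).
have mfg : measurable_fun setT (fun x => f x - g x) by exact: measurable_funB.
have infg := bounded_integrable measurableT mfg (fun x _ => fg x).
rewrite -RintegralB// (le_trans (le_normr_Rintegral _ infg))//.
have -> : e = \int[P]_x (cst e x).
  rewrite /= Rintegral_cst// -[LHS]mulr1 -[1 in LHS]/(fine 1%E); congr (e * fine _).
  by apply: esym; exact: probability_setT.
apply: le_Rintegral => //.
  exact: integrable_norm.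
by apply: (@bounded_integrable _ _ e) => // x _; rewrite /= ger0_norm.
Qed.

Lemma bounded_convergence (D : set T) (fn : nat -> T -> R) (f : T -> R) (M : R) :
  measurable D ->
  (forall n, measurable_fun D (fn n)) -> measurable_fun D f ->
  (forall n x, D x -> `|fn n x| <= M) ->
  (forall x, D x -> fn n x @[n --> \oo] --> f x) ->
  \int[P]_(x in D) fn n x @[n --> \oo] --> \int[P]_(x in D) f x.
Proof.
move=> mD mfn mf fnM fnf.
have mfn' n : measurable_fun D (EFin \o fn n) by exact/measurable_EFinP.
have mf' : measurable_fun D (EFin \o f) by exact/measurable_EFinP.
have cv : {ae P, forall x, D x -> (EFin \o fn n) x @[n --> \oo] --> (EFin \o f) x}.
  apply: aeW => x Dx; apply/fine_cvgP; split; first exact: nearW.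
  exact: fnf.
have iM : P.-integrable D (EFin \o cst M) by exact: (@bounded_integrable _ _ `|M|).
have dom : {ae P, forall x n, D x -> (`|(EFin \o fn n) x| <= (EFin \o cst M) x)%E}.
  by apply: aeW => x n Dx; rewrite lee_fin fnM.
have [inf _ H] := dominated_convergence mD mfn' mf' cv iM dom.
rewrite /Rintegral; apply: fine_cvg.
by rewrite fineK// integrable_fin_num.
Qed.

End bounded_integrals.

Lemma ex_image_probability d1 d2 (T1 : measurableType d1) (T2 : measurableType d2)
    (R : realType) (P : probability T1 R) (X : T1 -> T2) :
  measurable_fun setT X -> exists Q : probability T2 R,
    (forall A, Q A = P (X @^-1` A)) /\
    (forall (g : T2 -> R) (M : R), measurable_fun setT g -> (forall x, `|g x| <= M) ->
       \int[Q]_x g x = \int[P]_x g (X x)).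
Proof.
move=> mX.
pose X' : {mfun T1 >-> T2} := HB.pack X (isMeasurableFun.Build _ _ _ _ X mX).
exists (distribution P X'); split=> // g M mg gM.
rewrite /Rintegral /distribution integral_pushforward//.
  exact/measurable_EFinP.
rewrite preimage_setT; apply: (@bounded_integrable _ _ _ _ _ _ M) => //.
exact: measurableT_comp.
Qed.

(** The identity of [0,1) under Lebesgue measure.  It is replaced by 0 outside of [0,1),
    a negligible set, so that U lies in [0,1) everywhere. *)
Lemma ex_uniform_variable (R : realType) : exists (P : probability (measurableTypeR R) R)
    (U : R -> R), [/\ forall t, 0 <= U t < 1,
      forall a b, measurable (U @^-1` `[a, b[) &
      forall a b : R, 0 <= a -> a <= b -> b <= 1 -> P (U @^-1` `[a, b[) = (b - a)%:E].
Proof.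
pose D : set (measurableTypeR R) := `[0, 1[%classic.
have mD : measurable D by exact: measurable_itv.
have D1 : mrestr (@lebesgue_measure R) mD setT = 1%E.
  by rewrite /mrestr setTI /D lebesgue_measure_itv/= lte_fin ltr01 oppr0 adde0.
pose P : probability (measurableTypeR R) R := HB.pack (mrestr (@lebesgue_measure R) mD)
  (Measure_isProbability.Build _ _ _ (mrestr (@lebesgue_measure R) mD) D1).
pose U (t : R) : R := if t \in D then t else 0.
exists P, U; split.
- move=> t; rewrite /U; case: ifPn => [|_]; last by rewrite lexx ltr01.
  by rewrite inE /D /= in_itv.
- move=> a b.
  have -> : U @^-1` `[a, b[ = (D `&` `[a, b[) `|` (~` D `&` [set _ | 0 \in `[a, b[]).
    apply/seteqP; split=> t /=; rewrite /U; case: ifPn.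
      by rewrite inE => Dt; left.
      by move=> /negP; rewrite inE => Dt; right.
      by rewrite inE => Dt [[]//|[]].
    by move=> /negP; rewrite inE => Dt [[]//|[]].
  apply: measurableU; first by apply: measurableI => //; exact: measurable_itv.
  apply: measurableI; first exact: measurableC.
  have [h|h] := boolP (0 \in `[a, b[).
    by rewrite (_ : [set _ | _] = setT)//; apply/seteqP; split.
  by rewrite (_ : [set _ | _] = set0)//; apply/seteqP; split.
- move=> a b a0 ab b1.
  have -> : P (U @^-1` `[a, b[) = lebesgue_measure `[a, b[%classic.
    transitivity (mrestr (@lebesgue_measure R) mD (U @^-1` `[a, b[)); first by [].
    rewrite /mrestr; congr (lebesgue_measure _).
    apply/seteqP; split=> t /=.
      by move=> [+ Dt]; rewrite /U mem_set.
    move=> tab; have Dt : D t.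
      move: tab; rewrite /D /= !in_itv /= => /andP[at_ tb].
      by rewrite (le_trans a0 at_) (lt_le_trans tb b1).
    by rewrite /U mem_set.
  rewrite lebesgue_measure_itv/= lte_fin.
  by move: ab; rewrite le_eqVlt => /predU1P[->|->//]; rewrite ltxx subrr.
Qed.

(** * Borel sets and the torus *)

Section borel.
Variables (R : realType) (d : nat).

Lemma open_borel (A : set 'rV[R]_d) : open A -> measurable (A : set (borelRd R d)).
Proof. by move=> oA; apply: sub_sigma_algebra. Qed.

Lemma continuous_borel (f : 'rV[R]_d -> R) :
  continuous f -> measurable_fun setT (f : borelRd R d -> R).
Proof.
move=> cf; apply: (measurability _ (RGenOpens.measurableE R)) => //.
move=> _ [_ [a [b ->]] <-]; rewrite setTI; apply: open_borel.
by apply: open_comp => [x _|]; [exact: cf|exact: interval_open].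
Qed.

Lemma measurable_to_borel d1 (T : measurableType d1) (X : T -> 'rV[R]_d) :
  (forall A, open A -> measurable (X @^-1` A)) ->
  measurable_fun setT (X : T -> borelRd R d).
Proof.
move=> H; apply: (@measurability _ _ _ (borelRd R d) _ _ (@open 'rV[R]_d)) => //.
by move=> _ [A oA <-]; rewrite setTI; exact: H.
Qed.

Lemma measurable_box (a : 'rV[R]_d) :
  measurable ([set y : 'rV[R]_d | forall i, a 0 i <= y 0 i < a 0 i + 1]
    : set (borelRd R d)).
Proof.
have -> : [set y : 'rV[R]_d | forall i, a 0 i <= y 0 i < a 0 i + 1] =
    \bigcap_(i in [set: 'I_d])
      ((fun y : 'rV[R]_d => y 0 i) @^-1` `[a 0 i, a 0 i + 1[).
  apply/seteqP; split=> [y H i _ /=|y H i]; first by rewrite in_itv; exact: H.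
  by have := H i Logic.I; rewrite /= in_itv.
apply: fin_bigcap_measurable => // i _; rewrite -[X in measurable X]setTI.
apply: continuous_borel => //; exact: coord_continuous.
Qed.

Lemma measurable_torus : measurable (torus R d : set (borelRd R d)).
Proof.
have := measurable_box 0; congr measurable; apply/seteqP.
by split=> y H i; have := H i; rewrite mxE add0r.
Qed.

Lemma measurable_frac : measurable_fun setT (@frac R d : borelRd R d -> borelRd R d).
Proof.
apply: measurable_to_borel => A oA.
pose k_ (k : 'rV[int]_d) : 'rV[R]_d := map_mx intr k.
(* on the box of side one with lower corner - k, frac is the translation by k *)
have -> : @frac R d @^-1` A = \bigcup_(k in [set: 'rV[int]_d])
    ([set y | A (y + k_ k)] `&`
     [set y | forall i, (- k_ k) 0 i <= y 0 i < (- k_ k) 0 i + 1]).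
  apply/seteqP; split=> [y Ay|y [k _ [/= Ay yk]]].
    exists (\row_i - Num.floor (y 0 i)) => //; split=> // i.
    have /andP[h1] := floor_itv (y 0 i); rewrite intrD => h2.
    by rewrite !mxE intrN opprK h1.
  rewrite /preimage /= /frac; suff -> : (\row_i - Num.floor (y 0 i)) = k by [].
  apply/rowP => i; rewrite mxE (@floor_def _ _ (- k 0 i)) ?opprK//.
  by have := yk i; rewrite !mxE intrD !intrN.
apply: countable_bigcupT_measurable => // k.
apply: measurableI; last exact: measurable_box.
apply: open_borel.
suff : open ((fun y => y + k_ k) @^-1` A) by [].
apply: open_comp => // x _; exact: (cvgD cvg_id (cvg_cst _)).
Qed.

(** A uniform limit with known rate is measurable as soon as its approximations are: X t
    belongs to the open set A if and only if, for some n, the closed ball of radius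
    C 2^-n around Z n t is contained in A. *)
Lemma measurable_limit d1 (T : measurableType d1) (X : T -> 'rV[R]_d)
    (Z : nat -> T -> 'rV[R]_d) (C : R) :
  (forall n t, `|X t - Z n t| <= C / 2 ^+ n) ->
  (forall n S, measurable (Z n @^-1` S)) ->
  measurable_fun setT (X : T -> borelRd R d).
Proof.
move=> XZ mZ; apply: measurable_to_borel => A oA.
have -> : X @^-1` A =
    \bigcup_n (Z n @^-1` [set z | forall x, `|x - z| <= C / 2 ^+ n -> A x]).
  apply/seteqP; split=> [t At|t [n _]]; last by apply; exact: XZ.
  have /nbhs_ballP[e /= e0 eA] : nbhs (X t) A by exact: open_nbhs_nbhs.
  have [n ne] := geometric_small (2 * C) e0.
  exists n => // x xZ; apply: eA; rewrite -ball_normE /=.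
  apply: le_lt_trans ne; rewrite (le_trans (ler_distD (Z n t) _ _))//.
  by rewrite mulr_natl mulr2n mulrDl lerD// distrC.
by apply: bigcupT_measurable => n; exact: mZ.
Qed.

End borel.

(** * Means on bounded functions *)

Definition bounded_fun (R : realType) (T : Type) (f : T -> R) :=
  exists M : R, forall x, `|f x| <= M.

(** A finitely additive probability, given as a functional on all bounded functions,
    measurable or not. *)
Definition is_mean (R : realType) (T : Type) (Lam : (T -> R) -> R) :=
  [/\ forall f g, bounded_fun f -> bounded_fun g ->
        Lam (fun x => f x + g x) = Lam f + Lam g,
      forall c f, bounded_fun f -> Lam (fun x => c * f x) = c * Lam f,
      forall f g, bounded_fun f -> bounded_fun g ->
        (forall x, f x <= g x) -> Lam f <= Lam g
    & Lam (fun=> 1) = 1].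

Section bounded_fun.
Variables (R : realType) (T : Type).
Implicit Types f g : T -> R.

Lemma bounded_cst (c : R) : bounded_fun (fun _ : T => c).
Proof. by exists `|c|. Qed.

Lemma boundedD f g : bounded_fun f -> bounded_fun g -> bounded_fun (fun x => f x + g x).
Proof.
move=> [M fM] [N gN]; exists (M + N) => x.
by rewrite (le_trans (ler_normD _ _))// lerD.
Qed.

Lemma boundedZ c f : bounded_fun f -> bounded_fun (fun x => c * f x).
Proof.
by move=> [M fM]; exists (`|c| * M) => x; rewrite normrM ler_wpM2l.
Qed.

Lemma boundedB f g : bounded_fun f -> bounded_fun g -> bounded_fun (fun x => f x - g x).
Proof.
move=> [M fM] [N gN]; exists (M + N) => x.
by rewrite (le_trans (ler_normB _ _))// lerD.
Qed.

Lemma bounded_nat_bool (p : T -> bool) : bounded_fun (fun x => (p x)%:R : R).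
Proof. by exists 1 => x; case: (p x); rewrite ?normr1 ?normr0. Qed.

Lemma bounded_sum (I : Type) (s : seq I) (F : I -> T -> R) :
  (forall i, bounded_fun (F i)) -> bounded_fun (fun x => \sum_(i <- s) F i x).
Proof.
move=> bF; elim: s => [|i s IH].
  rewrite (_ : (fun _ => _) = fun=> 0); first exact: bounded_cst.
  by apply/funext => x; rewrite big_nil.
rewrite (_ : (fun _ => _) = fun x => F i x + \sum_(j <- s) F j x); first exact: boundedD.
by apply/funext => x; rewrite big_cons.
Qed.

Variable Lam : (T -> R) -> R.
Hypothesis mL : is_mean Lam.

Lemma mean_cst c : Lam (fun=> c) = c.
Proof.
case: mL => _ Lz _ L1; have := Lz c _ (bounded_cst 1); rewrite L1 mulr1 => {2}<-.
by congr Lam; apply/funext => x; rewrite mulr1.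
Qed.

Lemma meanB f g : bounded_fun f -> bounded_fun g ->
  Lam (fun x => f x - g x) = Lam f - Lam g.
Proof.
case: mL => La Lz _ _ bf bg.
have := La f _ bf (boundedZ (- 1) bg); rewrite Lz// mulN1r => <-.
by congr Lam; apply/funext => x; rewrite mulN1r.
Qed.

Lemma mean_sum (I : Type) (s : seq I) (F : I -> T -> R) :
  (forall i, bounded_fun (F i)) ->
  Lam (fun x => \sum_(i <- s) F i x) = \sum_(i <- s) Lam (F i).
Proof.
case: (mL) => La _ _ _ bF; elim: s => [|i s IH].
  by rewrite big_nil -[RHS](mean_cst 0); congr Lam; apply/funext => x; rewrite big_nil.
rewrite big_cons -IH -La//; last exact: bounded_sum.
by congr Lam; apply/funext => x; rewrite big_cons.
Qed.

Lemma mean_close f g e : bounded_fun f -> bounded_fun g ->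
  (forall x, `|f x - g x| <= e) -> `|Lam f - Lam g| <= e.
Proof.
move=> bf bg fg; case: (mL) => _ _ Lm _; rewrite -meanB// ler_norml.
have bfg := boundedB bf bg.
rewrite -{1}(mean_cst (- e)) -{2}(mean_cst e).
by apply/andP; split; (apply: Lm => //; [exact: bounded_cst|]) => x;
  have := fg x; rewrite ler_norml => /andP[].
Qed.

End bounded_fun.

(** * Coding the torus by refining partitions *)

Section cells.
Variables (R : realType) (d : nat).

Definition cell_size (n : nat) := #|{ffun 'I_d -> 'I_(2 ^ n).+1}|.

(** The dyadic cube of side 2^-n that contains frac y.  The ordinals have one value
    too many because inord requires a successor. *)
Definition cell (n : nat) (y : 'rV[R]_d) : 'I_(cell_size n) :=
  enum_rank [ffun i => inord (Num.truncn (2 ^+ n * frac y 0 i)) : 'I_(2 ^ n).+1].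

Lemma cell_close n y y' : cell n y = cell n y' -> `|frac y - frac y'| <= 1 / 2 ^+ n.
Proof.
move=> /enum_rank_inj /ffunP yy'; apply: rV_norm_le => [|i].
  by rewrite divr_ge0// exprn_ge0.
rewrite mxE [X in _ + X]mxE.
have p0 : 0 < 2 ^+ n :> R by rewrite exprn_gt0.
have f0 (z : 'rV[R]_d) : 0 <= 2 ^+ n * frac z 0 i.
  by rewrite mulr_ge0 ?(ltW p0)//; case/andP: (frac_torus z i).
have tr (z : 'rV[R]_d) : (Num.truncn (2 ^+ n * frac z 0 i)%R < (2 ^ n).+1)%N.
  rewrite ltnW// ltnS truncn_lt_nat// natrX.
  by rewrite gtr_pMr//; case/andP: (frac_torus z i).
have := yy' i; rewrite !ffunE => /(congr1 val) /=.
rewrite !inordK// => e.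
have /andP[a1 a2] := truncn_itv (f0 y); have /andP[b1 b2] := truncn_itv (f0 y').
rewrite e in a1 a2.
rewrite ler_pdivlMr// -{1}(ger0_norm (ltW p0)) -normrM.
rewrite ler_norml; rewrite -natr1 in a2 b2; apply/andP; split; lra.
Qed.

Lemma cell_size_gt0 n : (0 < cell_size n)%N.
Proof. by apply: leq_ltn_trans (ltn_ord (cell n 0)). Qed.

Fixpoint code_size (n : nat) : nat :=
  if n is m.+1 then (code_size m * cell_size m)%N else 1%N.

(** The cells of all levels below n, written as a number in mixed radix.  Dropping the
    last digit is a division, hence monotone: this is why the distribution functions
    of the codes of different levels are compatible. *)
Fixpoint code (n : nat) (y : 'rV[R]_d) : nat :=
  if n is m.+1 then (code m y * cell_size m + cell m y)%N else 0%N.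

Lemma code_lt n y : (code n y < code_size n)%N.
Proof.
elim: n => [//|n IH] /=.
apply: (@leq_trans ((code n y).+1 * cell_size n)); last by rewrite leq_mul2r IH orbT.
by rewrite mulSn addnC ltn_add2r.
Qed.

Lemma code_div n y : (code n.+1 y %/ cell_size n)%N = code n y.
Proof. by rewrite /= divnMDl ?cell_size_gt0// divn_small ?addn0. Qed.

Lemma code_close n y y' : code n.+1 y = code n.+1 y' ->
  `|frac y - frac y'| <= 1 / 2 ^+ n.
Proof.
move=> e; apply: cell_close; apply: val_inj => /=.
by have := congr1 (modn^~ (cell_size n)) e; rewrite /= !modnMDl !modn_small.
Qed.

Lemma code_lt_mul n y j : (code n.+1 y < j * cell_size n)%N = (code n y < j)%N.
Proof. by rewrite -ltn_divLR ?cell_size_gt0// code_div. Qed.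

End cells.

(** * Representation of means by measures *)

Section quantile.
Variables (R : realType) (d : nat) (Lam : ('rV[R]_d -> R) -> R).
Hypothesis mL : is_mean Lam.

Definition code_cdf (n j : nat) : R := Lam (fun y => (code n y < j)%N%:R).

Lemma code_cdf0 n : code_cdf n 0 = 0.
Proof. by rewrite -[RHS](mean_cst mL 0); congr Lam; apply/funext => y; rewrite ltn0. Qed.

Lemma code_cdf_size n : code_cdf n (code_size d n) = 1.
Proof.
by rewrite -[RHS](mean_cst mL 1); congr Lam; apply/funext => y; rewrite code_lt.
Qed.

Lemma le_code_cdf n : {homo code_cdf n : j k / (j <= k)%N >-> j <= k}.
Proof.
move=> j k jk; case: mL => _ _ Lm _; apply: Lm; try exact: bounded_nat_bool.
by move=> y; rewrite ler_nat; case: ltnP => // /leq_trans/(_ jk) ->.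
Qed.

Lemma code_cdf_ge0 n j : 0 <= code_cdf n j.
Proof. by rewrite -(code_cdf0 n) le_code_cdf. Qed.

Lemma code_cdf_le1 n j : code_cdf n j <= 1.
Proof.
rewrite -[leRHS](mean_cst mL 1); case: mL => _ _ Lm _.
apply: Lm; [exact: bounded_nat_bool|exact: bounded_cst|].
by move=> y; case: (_ < _)%N.
Qed.

Lemma code_cdf_mul n j : code_cdf n.+1 (j * cell_size d n) = code_cdf n j.
Proof. by congr Lam; apply/funext => y; rewrite code_lt_mul. Qed.

(** The inverse of the distribution function.  The default value is met only outside
    of 0 <= u < 1. *)
Definition quantile (n : nat) (u : R) : nat :=
  xget 0%N [set j | code_cdf n j <= u < code_cdf n j.+1].

Lemma quantile_uniq n (u : R) j k : code_cdf n j <= u < code_cdf n j.+1 ->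
  code_cdf n k <= u < code_cdf n k.+1 -> j = k.
Proof.
suff H a b : code_cdf n a <= u < code_cdf n a.+1 ->
    code_cdf n b <= u < code_cdf n b.+1 -> (a <= b)%N.
  by move=> Hj Hk; apply/eqP; rewrite eqn_leq (H j k) ?(H k j).
move=> /andP[au _] /andP[_ ub]; rewrite leqNgt; apply/negP => /(le_code_cdf n) ba.
by have := lt_le_trans ub (le_trans ba au); rewrite ltxx.
Qed.

Lemma quantileP n (u : R) : 0 <= u < 1 ->
  code_cdf n (quantile n u) <= u < code_cdf n (quantile n u).+1.
Proof.
move=> /andP[u0 u1].
have ex : exists j, u < code_cdf n j.+1.
  exists (code_size d n); rewrite (lt_le_trans u1)// -(code_cdf_size n).
  exact: le_code_cdf.
suff [j Hj] : exists j, code_cdf n j <= u < code_cdf n j.+1.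
  exact: (@xgetPex _ 0%N [set j | code_cdf n j <= u < code_cdf n j.+1] (ex_intro _ j Hj)).
case: (ex_minnP ex) => -[|j] uj jmin.
  by exists 0%N; rewrite code_cdf0 u0.
exists j.+1; rewrite uj andbT leNgt; apply/negP => /jmin.
by rewrite ltnn.
Qed.

Lemma quantileE n (u : R) j : 0 <= u < 1 ->
  (quantile n u == j) = (code_cdf n j <= u < code_cdf n j.+1).
Proof.
move=> u01; apply/eqP/idP => [<-|]; first exact: quantileP.
exact: quantile_uniq (quantileP n u01).
Qed.

Lemma quantile_lt n (u : R) : 0 <= u < 1 -> (quantile n u < code_size d n)%N.
Proof.
move=> u01; rewrite ltnNge; apply/negP => /(le_code_cdf n).
have /andP[qu _] := quantileP n u01; rewrite code_cdf_size => /le_trans/(_ qu).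
by case/andP: u01 => _; rewrite ltNge => /negP.
Qed.

(** Dropping the last digit of a quantile gives the quantile of the previous level: one
    and the same u selects nested cells at all levels. *)
Lemma quantile_div n (u : R) : 0 <= u < 1 ->
  (quantile n.+1 u %/ cell_size d n)%N = quantile n u.
Proof.
move=> u01; apply/esym/eqP; rewrite quantileE//; set k := (_ %/ _)%N.
rewrite -(code_cdf_mul n k) -(code_cdf_mul n k.+1).
have /andP[h1 h2] := quantileP n.+1 u01.
rewrite (le_trans _ h1) ?(lt_le_trans h2)//; apply: le_code_cdf.
  by rewrite -ltn_divLR ?(cell_size_gt0 R).
exact: leq_trunc_div.
Qed.

(** A point with code j.  The default value is met only for codes that no point has,
    and quantile_code shows that quantiles avoid them. *)
Definition code_rep (n j : nat) : 'rV[R]_d := frac (xget 0 [set y | code n y = j]).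

Lemma code_rep_close n y : `|code_rep n.+1 (code n.+1 y) - frac y| <= 1 / 2 ^+ n.
Proof.
apply: code_close.
by apply: (@xgetPex _ 0 [set y' | code n.+1 y' = code n.+1 y]); exists y.
Qed.

(** A code without points carries no mass, so its interval of values of the
    distribution function is empty. *)
Lemma quantile_code n (u : R) : 0 <= u < 1 ->
  exists y : 'rV[R]_d, code n y = quantile n u.
Proof.
move=> u01; apply: contrapT => /forallNP H.
have /andP[h1 h2] := quantileP n u01.
have : code_cdf n (quantile n u).+1 = code_cdf n (quantile n u).
  congr Lam; apply/funext => y; rewrite ltnS leq_eqVlt.
  by have /eqP/negbTE -> := H y.
by move=> e; have := le_lt_trans h1 h2; rewrite e ltxx.
Qed.

Lemma code_rep_step n (u : R) : 0 <= u < 1 ->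
  `|code_rep n.+2 (quantile n.+2 u) - code_rep n.+1 (quantile n.+1 u)| <= 1 / 2 ^+ n.
Proof.
move=> u01; have [y2 e2] := quantile_code n.+2 u01.
pose y : 'rV[R]_d := xget 0 [set y | code n.+2 y = quantile n.+2 u].
have ey : code n.+2 y = quantile n.+2 u.
  by apply: (@xgetPex _ 0 [set y' | code n.+2 y' = quantile n.+2 u]); exists y2.
have e1 : code n.+1 y = quantile n.+1 u.
  by rewrite -(code_div n.+1 y) ey; exact: quantile_div.
have := code_rep_close n y; rewrite e1 distrC; exact.
Qed.

End quantile.

Section representation.
Variables (R : realType) (d : nat) (Lam : ('rV[R]_d -> R) -> R).
Hypothesis mL : is_mean Lam.

Lemma mean_code n (c : nat -> R) :
  Lam (fun y => c (code n y)) =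
  \sum_(j < code_size d n) c j * (code_cdf Lam n j.+1 - code_cdf Lam n j).
Proof.
pose ind j (y : 'rV[R]_d) : R := (code n y < j.+1)%N%:R - (code n y < j)%N%:R.
have bind j : bounded_fun (ind j) by apply: boundedB; exact: bounded_nat_bool.
have indE j y : ind j y = (code n y == j)%:R.
  rewrite /ind ltnS leq_eqVlt; have [->|_] /= := eqVneq (code n y) j.
    by rewrite ltnn subr0.
  by rewrite subrr.
have -> : (fun y => c (code n y)) = (fun y => \sum_(j < code_size d n) c j * ind j y).
  apply/funext => y; rewrite (bigD1 (Ordinal (code_lt n y)))//= indE eqxx mulr1.
  rewrite big1 ?addr0// => j /negbTE jy; rewrite indE.
  by rewrite eq_sym -val_eqE /= in jy *; rewrite jy mulr0.
rewrite (mean_sum mL) => [|j]; last exact: boundedZ.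
apply: eq_bigr => j _; case: (mL) => _ Lz _ _; rewrite Lz//; congr (_ * _).
by rewrite (meanB mL)//; exact: bounded_nat_bool.
Qed.

(** The quantile equals j on an interval whose length is the mass of the code j. *)
Lemma integral_code d1 (T : measurableType d1) (P : probability T R) (U : T -> R)
    n (c : nat -> R) :
  (forall t, 0 <= U t < 1) -> (forall a b, measurable (U @^-1` `[a, b[)) ->
  (forall a b : R, 0 <= a -> a <= b -> b <= 1 -> P (U @^-1` `[a, b[) = (b - a)%:E) ->
  \int[P]_t c (quantile Lam n (U t)) = Lam (fun y => c (code n y)).
Proof.
move=> U01 mU PU.
pose I j := U @^-1` `[code_cdf Lam n j, code_cdf Lam n j.+1[.
have II j t : (t \in I j) = (quantile Lam n (U t) == j).
  rewrite (quantileE mL)//; apply/idP/idP; first by rewrite inE /I /= in_itv.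
  by move=> h; rewrite inE /I /= in_itv.
have cE t : c (quantile Lam n (U t)) = \sum_(j < code_size d n) c j * \1_(I j) t.
  rewrite (bigD1 (Ordinal (quantile_lt mL n (U01 t))))//= indicE II eqxx mulr1.
  rewrite big1 ?addr0// => j /negbTE jy; rewrite indicE II.
  by rewrite eq_sym -val_eqE /= in jy *; rewrite jy mulr0.
have iI j : P.-integrable setT (EFin \o (fun t => c j * \1_(I j) t)).
  apply: (@bounded_integrable _ _ _ _ _ _ `|c j|) => //.
    by apply: measurable_funM => //; apply: measurable_indic; exact: mU.
  by move=> t _; rewrite normrM ler_piMr// ger0_norm ?indicE// lern1 leq_b1.
rewrite mean_code /Rintegral.
have -> : (\int[P]_t (c (quantile Lam n (U t)))%:E =
    \sum_(j < code_size d n) \int[P]_t (c j * \1_(I j) t)%:E)%E.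
  rewrite -integral_sum//; last by move=> j; exact: iI.
  by apply: eq_integral => t _; rewrite cE -sumEFin.
rewrite (eq_bigr (fun j : 'I_(code_size d n) =>
    (c j * (code_cdf Lam n j.+1 - code_cdf Lam n j))%:E)) => [|j _].
  by rewrite sumEFin.
rewrite -[LHS]fineK ?(integrable_fin_num measurableT (iI j))//; congr (_%:E).
transitivity (\int[P]_t (c j * \1_(I j) t)); first by [].
rewrite RintegralZl//; last first.
  apply: (@bounded_integrable _ _ _ _ _ _ 1) => //.
    by apply: measurable_indic; exact: mU.
  by move=> t _; rewrite ger0_norm ?indicE// lern1 leq_b1.
congr (_ * _); rewrite /Rintegral integral_indic//; last exact: mU.
rewrite setIT; transitivity (fine (code_cdf Lam n j.+1 - code_cdf Lam n j)%:E) => //.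
congr fine; apply: PU; [exact: code_cdf_ge0| |exact: code_cdf_le1].
exact: (le_code_cdf mL).
Qed.

(** A mean is represented on continuous functions by a measure, although it may fail to
    be countably additive.  The cells selected by a uniform variable U are nested, so
    their representatives Z n converge to a point X, and mu is the law of X modulo Z^d.
    At level n, phi (X) is close to phi (Z n), and phi is close to its value at the
    representative of its cell; the expectation of the former approximation equals
    the mean of the latter by integral_code. *)
Theorem mean_representation : exists mu : probability (borelRd R d) R,
  mu (torus R d) = 1%E /\
  forall phi, C0_sharp R d phi -> \int[mu]_(y in torus R d) phi y = Lam phi.
Proof.
have [P [U [U01 mU PU]]] := ex_uniform_variable R.
pose Z n t := code_rep R d n.+1 (quantile Lam n.+1 (U t)).
have mZ n S : measurable (Z n @^-1` S : set (measurableTypeR R)).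
  have -> : Z n @^-1` S = \bigcup_(j in [set j | S (code_rep R d n.+1 j)])
      (U @^-1` `[code_cdf Lam n.+1 j, code_cdf Lam n.+1 j.+1[).
    apply/seteqP; split=> [t St|t [j /= Sj]].
      exists (quantile Lam n.+1 (U t)) => //=.
      by rewrite in_itv; exact: quantileP.
    by rewrite in_itv -(quantileE mL)// /Z => /eqP ->.
  by apply: bigcup_measurable => j _; exact: mU.
have /choice[X XZ] : forall t, exists l, forall n, `|l - Z n t| <= 2 * 1 / 2 ^+ n.
  by move=> t; apply: geometric_cauchy => n; exact: code_rep_step.
have mX : measurable_fun setT (X : measurableTypeR R -> borelRd R d).
  exact: (measurable_limit (fun n t => XZ t n) mZ).
have mfX : measurable_fun setT (@frac R d \o X : measurableTypeR R -> borelRd R d).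
  exact: (measurableT_comp (@measurable_frac R d) mX).
have [mu [muE muint]] := ex_image_probability P mfX.
have mu1 : mu (torus R d) = 1%E.
  rewrite muE (_ : _ @^-1` _ = setT) ?probability_setT//.
  by apply/seteqP; split=> // t _; exact: frac_torus.
exists mu; split=> // phi phiC.
have [M M0 phiM] := C0_sharp_bounded phiC.
have mphi := continuous_borel phiC.1.
(* the complement of the torus is negligible *)
have -> : \int[mu]_(y in torus R d) phi y = \int[mu]_y phi y.
  have mT := @measurable_torus R d.
  have muC : mu (~` torus R d) = 0%E.
    by rewrite probability_setC// mu1 subee.
  rewrite /Rintegral [in RHS](negligible_integral (measurableC mT))//.
    by rewrite setDE setCK setTI.
  exact: (@bounded_integrable _ (borelRd R d) R mu setT phi M).
rewrite (muint _ _ mphi phiM).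
have -> : \int[P]_t phi ((@frac R d \o X) t) = \int[P]_t phi (X t).
  by apply: eq_Rintegral => t _; rewrite /= periodic_frac//; case: phiC.
apply/eqP; rewrite -subr_eq0 -normr_le0; apply/ler_addgt0Pr => e e0; rewrite add0r.
have e2 : 0 < e / 2 by rewrite divr_gt0.
have [dl dl0 Hdl] := C0_sharp_unif_continuous phiC e2.
have [n nd] := geometric_small (2 * 1) dl0.
pose c j := phi (code_rep R d n.+1 j).
have cb : bounded_fun (fun y : 'rV[R]_d => c (code n.+1 y)).
  by exists M => y; exact: phiM.
have H1 : `|\int[P]_t phi (X t) - \int[P]_t c (quantile Lam n.+1 (U t))| <= e / 2.
  apply: (@Rintegral_close _ _ _ _ _ _ M) => //.
  - exact: (measurableT_comp mphi mX).
  - have mZn : measurable_fun setT (Z n : measurableTypeR R -> borelRd R d).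
      by move=> _ A _; rewrite setTI; exact: mZ.
    exact: (measurableT_comp mphi mZn).
  - by move=> t; exact: phiM.
  - by move=> t; apply/ltW/Hdl; exact: le_lt_trans (XZ t n) nd.
have H2 : `|Lam (fun y => c (code n.+1 y)) - Lam phi| <= e / 2.
  apply: (mean_close mL) => //; first by exists M.
  move=> y; rewrite -(periodic_frac y phiC.2); apply/ltW/Hdl.
  apply: le_lt_trans nd; rewrite (le_trans (code_rep_close _ _))//.
  by rewrite ler_pM2r ?invr_gt0 ?exprn_gt0// mulr1 ler1n.
rewrite (@integral_code _ (measurableTypeR R) P U n.+1 c U01 mU PU) in H1.
by rewrite (splitr e); exact: le_trans (ler_distD _ _ _) (lerD H1 H2).
Qed.

End representation.

(** * Ultrafilter limits of averages *)

Section ultramean.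
Variables (R : realType) (T : Type) (U : set_system nat).
Hypothesis UU : UltraFilter U.

Lemma ultra_cvg (u : nat -> R) : bounded_fun u -> cvg (u @ U).
Proof.
move=> [M uM].
have UI : UltraFilter (u @ U).
  split; first exact: fmap_proper_filter.
  move=> G PG UG; rewrite predeqE => A; split=> [GA|]; last exact: UG.
  have [//|nA] := in_ultra_setVsetC (u @^-1` A) UU.
  have GAA : G (A `&` ~` A) by apply: filterI => //; exact: UG.
  by have [y []] := filter_ex GAA.
have := @segment_compact R (- M) M; rewrite compact_ultra => /(_ (u @ U) _ _)[].
  change (U (u @^-1` `[- M, M])); apply: filterE => n.
  by rewrite /= in_itv /= -ler_norml.
by move=> l [_ ul]; apply/cvg_ex; exists l.
Qed.

Variable A : nat -> (T -> R) -> R.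
Hypothesis mA : forall j, is_mean (A j).

(** An ultrafilter makes the averages of all bounded functions converge at once.  The
    limit is thus defined on indicator functions of cells as well, which a
    subsequence extracted for a dense family of continuous functions would not give. *)
Definition ultra_mean (f : T -> R) : R := lim (A j f @[j --> U]).

Lemma ultra_mean_cvg f : bounded_fun f -> A j f @[j --> U] --> ultra_mean f.
Proof.
move=> bf; apply: ultra_cvg; case: (bf) => M fM; exists M => j.
rewrite -[A j f]subr0 -(mean_cst (mA j) 0).
apply: (mean_close (mA j)) => //; first exact: bounded_cst.
by move=> x; rewrite subr0.
Qed.

Lemma ultra_mean_eq f l : A j f @[j --> U] --> l -> ultra_mean f = l.
Proof. by move=> fl; apply: cvg_lim. Qed.

Lemma ultra_mean_is_mean : is_mean ultra_mean.
Proof.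
split.
- move=> f g bf bg; apply: ultra_mean_eq.
  rewrite (_ : (fun j => _) = (fun j => A j f + A j g)).
    by apply: cvgD; exact: ultra_mean_cvg.
  by apply/funext => j; case: (mA j) => ->.
- move=> c f bf; apply: ultra_mean_eq.
  rewrite (_ : (fun j => _) = (fun j => c * A j f)).
    by apply: cvgMr; exact: ultra_mean_cvg.
  by apply/funext => j; case: (mA j) => _ ->.
- move=> f g bf bg fg; apply: ler_cvg_to (ultra_mean_cvg bf) (ultra_mean_cvg bg) _.
  by apply: nearW => j; case: (mA j) => _ _ + _; apply.
- apply: ultra_mean_eq; rewrite (_ : (fun j => _) = cst 1); first exact: cvg_cst.
  by apply/funext => j; case: (mA j).
Qed.

End ultramean.

Section average.
Variables (R : realType) (T : Type).

Definition average (N : nat) (w : nat -> T) (f : T -> R) : R :=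
  N%:R^-1 * \sum_(k < N) f (w k).

Lemma average_is_mean N w : (0 < N)%N -> is_mean (average N w).
Proof.
move=> N0; split.
- by move=> f g _ _; rewrite /average big_split mulrDr.
- by move=> c f _; rewrite /average -mulr_sumr mulrCA.
- move=> f g _ _ fg; rewrite /average ler_wpM2l ?invr_ge0//.
  exact: ler_sum.
- by rewrite /average sumr_const card_ord mulVf// pnatr_eq0 -lt0n.
Qed.

(** A shift by one changes the sum by its two end terms only. *)
Lemma sum_shift_le (g : nat -> R) (B : R) (N m : nat) : (forall k, `|g k| <= B) ->
  `|\sum_(k < N) g (k + m)%N - \sum_(k < N) g k| <= 2 * m%:R * B.
Proof.
move=> gB; elim: m => [|m IH].
  rewrite mulr0 mul0r; under eq_bigr do rewrite addn0.
  by rewrite subrr normr0.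
rewrite (le_trans (ler_distD (\sum_(k < N) g (k + m)%N) _ _))//.
have -> : 2 * m.+1%:R * B = B + B + 2 * m%:R * B by rewrite -natr1; ring.
apply: lerD IH.
have -> : \sum_(k < N) g (k + m.+1)%N = \sum_(k < N) g (k + m)%N + g (N + m)%N - g m.
  have := @big_ord_recr R 0 +%R N (fun k => g (k + m)%N).
  rewrite big_ord_recl /= add0n => <-; rewrite [RHS]addrC addKr.
  by apply: eq_bigr => k _; rewrite /bump /= add1n addSnnS.
by rewrite addrAC [_ + g _]addrC addrK (le_trans (ler_normB _ _))// lerD.
Qed.

End average.

(** * Limit points are rotation vectors *)

Lemma cvg_inv_nat (R : realType) (C : R) (u : nat -> R) (l : R) :
  (forall j, `|u j - l| <= C / j.+1%:R) -> u @ \oo --> l.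
Proof.
move=> H; apply/cvgrPdist_le => e e0.
have : (fun j => C * harmonic j : R) @ \oo --> C * 0.
  by apply: cvgMr; exact: cvg_harmonic.
rewrite mulr0 => /cvgrPdist_le/(_ e e0); apply: filterS => j.
rewrite sub0r normrN => h; rewrite distrC (le_trans (H j))//.
exact: le_trans (ler_norm _) h.
Qed.

Section asymptotic.
Variables (R : realType) (d : nat) (b : 'rV[R]_d -> 'rV[R]_d).

Definition limit_point (x c : 'rV[R]_d) := forall (e : R) (n : nat), 0 < e ->
  exists2 k : nat, (n <= k)%N & `|c - k%:R^-1 *: flow b k%:R x| < e.

Lemma asymptotic_setP c :
  asymptotic_set b c <-> exists2 x, torus R d x & limit_point x c.
Proof.
split=> [[x xT H]|[x xT H]]; exists x => //.
  move=> e n e0; have /(_ _ (nbhsx_ballx c e e0)) := H (maxn n 1) (leq_maxr _ _).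
  move=> [_ [[k /= nk <-] ck]]; exists k; first exact: leq_trans (leq_maxl _ _) nk.
  by move: ck; rewrite -ball_normE.
move=> n n1 B /nbhs_ballP[e /= e0 eB]; have [k nk ck] := H e n e0.
exists (k%:R^-1 *: flow b k%:R x); split; first by exists k.
by apply: eB; rewrite -ball_normE.
Qed.

End asymptotic.

Section krylov_bogoliubov.
Variables (R : realType) (d : nat) (b : 'rV[R]_d -> 'rV[R]_d).
Hypothesis hb : lipschitz_field b.

(** The times k / n with k < n^2 cover [0,n]: as n grows, the length of the orbit tends
    to infinity and the mesh to 0. *)
Let sample (n : nat) (x : 'rV[R]_d) (k : nat) : 'rV[R]_d := flow b (k%:R / n%:R) x.

(** Flowing during time t amounts to shifting the sampling index by the integer part m
    of t n, up to a time lag smaller than 1 / n; the shift changes the average by at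
    most 2 m B / n^2 <= 2 t B / n. *)
Lemma average_flow (phi : 'rV[R]_d -> R) (x : 'rV[R]_d) (t e : R) :
  C0_sharp R d phi -> 0 <= t -> 0 < e ->
  exists C : R, 0 <= C /\ forall n : nat, (0 < n)%N ->
    C / n%:R <= e ->
    `|average (n * n) (sample n x) (phi \o flow b t) -
      average (n * n) (sample n x) phi| <= e.
Proof.
move=> Cphi t0 e0.
have [B B0 phiB] := C0_sharp_bounded Cphi.
have e2 : 0 < e / 2 by rewrite divr_gt0.
have [dl dl0 Hdl] := C0_sharp_unif_continuous Cphi e2.
have [M M0 bM] : exists2 M : R, 0 < M & forall x, `|b x| <= M by case: hb.
pose C1 := 2 * M * e / dl; pose C2 := 4 * t * B.
have C10 : 0 <= C1 by rewrite divr_ge0 ?mulr_ge0// ltW.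
have C20 : 0 <= C2 by rewrite !mulr_ge0// ltW.
(* C1 / n <= e gives M / n < dl, so that one sampling step is invisible to phi up
   to e / 2; C2 / n <= e makes the effect of a shift of the indices at most e / 2 *)
exists (C1 + C2); split; first exact: addr_ge0.
move=> n n0 Cn.
have np : 0 < n%:R :> R by rewrite ltr0n.
pose m := Num.truncn (t * n%:R).
have /andP[m1 m2] : m%:R <= t * n%:R < m.+1%:R by rewrite truncn_itv// mulr_ge0// ltW.
have near k : `|phi (flow b t (sample n x k)) - phi (sample n x (k + m)%N)| <= e / 2.
  apply/ltW/Hdl; rewrite -(flowD hb) /sample.
  rewrite (le_lt_trans (flow_speed hb _ _ _ bM))// natrD.
  have -> : t + k%:R / n%:R - (k%:R + m%:R) / n%:R = (t * n%:R - m%:R) / n%:R.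
    by field; rewrite gt_eqF.
  rewrite normrM (ger0_norm (x := _^-1)) ?invr_ge0 ?(ltW np)// ger0_norm ?subr_ge0//.
  apply: (@le_lt_trans _ _ (M / n%:R)).
    rewrite mulrA ler_wpM2r ?invr_ge0 ?(ltW np)// ler_piMr ?(ltW M0)//.
    by rewrite lerBlDr addrC natr1 ltW.
  have : C1 / n%:R <= e.
    by apply: le_trans Cn; rewrite ler_wpM2r ?invr_ge0 ?(ltW np)// lerDl.
  rewrite /C1 => H; rewrite ltr_pdivrMr//.
  have {}H : 2 * M <= dl * n%:R.
    move: H; rewrite ler_pdivrMr// ler_pdivrMr// => H.
    by rewrite -(ler_pM2r e0) (le_trans H)// le_eqVlt; apply/orP; left; apply/eqP; ring.
  lra.
rewrite /average -mulrBr normrM ger0_norm ?invr_ge0//.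
rewrite ler_pdivrMl ?ltr0n ?muln_gt0 ?n0//.
rewrite (le_trans (ler_distD (\sum_(k < n * n) phi (sample n x (k + m)%N)) _ _))//.
have -> : (n * n)%:R * e = (n * n)%:R * (e / 2) + (n * n)%:R * (e / 2) by field.
apply: lerD.
  rewrite -sumrB (le_trans (ler_norm_sum _ _ _))//.
  rewrite -[X in X%:R * _](card_ord (n * n)) mulr_natl -sumr_const.
  by apply: ler_sum => k _; exact: near.
apply: (le_trans (sum_shift_le (n * n) m (fun k => phiB (sample n x k)))).
have : C2 / n%:R <= e.
  by apply: le_trans Cn; rewrite ler_wpM2r ?invr_ge0 ?(ltW np)// lerDr.
rewrite ler_pdivrMr// /C2 natrM => H.
have : m%:R * B <= t * n%:R * B by rewrite ler_wpM2r// ltW.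
have : n%:R * (4 * t * B) <= n%:R * (e * n%:R) by rewrite ler_wpM2l// ltW.
lra.
Qed.

(** The displacements over the n^2 steps of length h = 1 / n add up to the total
    displacement, and each one equals h b up to L M h^2. *)
Lemma average_field (M L : R) (x : 'rV[R]_d) i (n : nat) :
  (forall x, `|b x| <= M) -> 0 < L -> (forall x y, `|b x - b y| <= L * `|x - y|) ->
  (0 < n)%N ->
  `|average (n * n) (sample n x) (fun y => b y 0 i) - n%:R^-1 * (flow b n%:R x - x) 0 i|
    <= L * M / n%:R.
Proof.
move=> bM L0 bL n0.
have np : 0 < n%:R :> R by rewrite ltr0n.
pose h : R := n%:R^-1; have h0 : 0 <= h by rewrite invr_ge0 ltW.
have tel : (flow b n%:R x - x) 0 i =
    \sum_(k < n * n) (flow b h (sample n x k) - sample n x k) 0 i.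
  have -> : flow b n%:R x - x =
      \sum_(0 <= k < n * n) (sample n x k.+1 - sample n x k).
    rewrite telescope_sumr// /sample mul0r (flow0 hb) natrM mulfK ?gt_eqF//.
  rewrite big_mkord summxE; apply: eq_bigr => k _.
  have -> // : sample n x k.+1 = flow b h (sample n x k).
  by rewrite /sample -(flowD hb) /h -natr1 mulrDl mul1r addrC.
have -> : average (n * n) (sample n x) (fun y => b y 0 i) -
    n%:R^-1 * (flow b n%:R x - x) 0 i =
  - h * \sum_(k < n * n)
      (flow b h (sample n x k) - sample n x k - h *: b (sample n x k)) 0 i.
  rewrite tel /average natrM.
  under [in RHS]eq_bigr do rewrite mxE [X in _ + X]mxE [X in _ - X]mxE.
  rewrite sumrB -mulr_sumr /h; field; rewrite gt_eqF//.
rewrite normrM normrN (ger0_norm h0) ler_pdivlMr// mulrAC /h mulVf ?gt_eqF// mul1r.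
rewrite (le_trans (ler_norm_sum _ _ _))//.
rewrite (@le_trans _ _ (\sum_(k < n * n) (L * M * h * h)))//.
  apply: ler_sum => k _; rewrite (le_trans (coord_norm_le _ _))//.
  exact: displacement_field.
rewrite sumr_const card_ord -mulr_natl natrM /h le_eqVlt; apply/orP; left; apply/eqP.
by field; rewrite gt_eqF.
Qed.

(** The argument of Krylov and Bogoliubov.  Along times k j with X (k j, x) / k j close
    to a, the averages over the orbit of x have an ultrafilter limit, which is a mean
    invariant under the flow by average_flow and takes the value a on the field by
    average_field.  The measure that represents it is the required one. *)
Theorem asymptotic_sub_rotation : asymptotic_set b `<=` rotation_set b.
Proof.
move=> a /asymptotic_setP[x _ xa].
have [[M M0 bM] [L L0 bL]] : (exists2 M : R, 0 < M & forall x, `|b x| <= M) /\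
  (exists2 L : R, 0 < L & forall x y, `|b x - b y| <= L * `|x - y|) by case: hb.
have /choice[k kP] : forall j : nat, exists k : nat, (j.+1 <= k)%N /\
    `|a - k%:R^-1 *: flow b k%:R x| < j.+1%:R^-1.
  by move=> j; have [|k jk ka] := xa j.+1%:R^-1 j.+1; [rewrite invr_gt0|exists k].
have k0 j : (0 < k j)%N by apply: leq_ltn_trans (kP j).1.
have kh j : (k j)%:R^-1 <= j.+1%:R^-1 :> R.
  by rewrite lef_pV2 ?posrE ?ltr0n// ler_nat; case: (kP j).
have [U [UU ooU]] := ultraFilterLemma eventually_filter.
pose A (j : nat) : ('rV[R]_d -> R) -> R := average (k j * k j) (sample (k j) x).
have mA j : is_mean (A j) by apply: average_is_mean; rewrite muln_gt0 k0.
have mL := ultra_mean_is_mean UU mA.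
have toU (u : nat -> R) l : u @ \oo --> l -> u @ U --> l.
  by move=> ul W Wl; apply: ooU; exact: ul.
have bdd phi : C0_sharp R d phi -> bounded_fun phi.
  by move=> /C0_sharp_bounded[B _ HB]; exists B.
(* nonnegative times first; the group law then gives the negative ones *)
have inv_pos phi t : C0_sharp R d phi -> 0 <= t ->
    ultra_mean U A (phi \o flow b t) = ultra_mean U A phi.
  move=> Cphi t0; apply: ultra_mean_eq.
  have Cpt : C0_sharp R d (phi \o flow b t) by exact: C0_sharp_flow.
  rewrite (_ : (fun j => _) = (fun j => (A j (phi \o flow b t) - A j phi) + A j phi)).
    rewrite -[X in _ --> X]add0r.
    apply: cvgD; last exact: (ultra_mean_cvg UU mA (bdd _ Cphi)).
    apply: toU; apply/cvgrPdist_le => e e0.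
    have [C [C0 HC]] := average_flow x Cphi t0 e0.
    have : (fun j => C * harmonic j : R) @ \oo --> C * 0.
      by apply: cvgMr; exact: cvg_harmonic.
    rewrite mulr0 => /cvgrPdist_le/(_ e e0); apply: filterS => j.
    rewrite !sub0r !normrN => h; apply: HC => //.
    apply: le_trans (le_trans (ler_norm _) h).
    by rewrite ler_wpM2l.
  by apply/funext => j; rewrite subrK.
have inv phi t : C0_sharp R d phi ->
    ultra_mean U A (phi \o flow b t) = ultra_mean U A phi.
  move=> Cphi; have [t0|/ltW t0] := leP 0 t; first exact: inv_pos.
  have nt0 : 0 <= - t by rewrite oppr_ge0.
  rewrite -(inv_pos _ (- t) (C0_sharp_flow hb t Cphi) nt0).
  by congr (ultra_mean U A _); apply/funext => y /=; rewrite -(flowD hb) subrr (flow0 hb).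
have field i : ultra_mean U A (fun y => b y 0 i) = a 0 i.
  apply: ultra_mean_eq; apply: toU.
  apply: (@cvg_inv_nat _ (L * M + `|x| + 1)) => j.
  set z := (k j)%:R^-1 * (flow b (k j)%:R x - x) 0 i.
  rewrite (le_trans (ler_distD z _ _))// mulrDl mul1r mulrDl -addrA lerD//.
    apply: le_trans (average_field x i bM L0 bL (k0 j)) _.
    by rewrite ler_wpM2l// mulr_ge0// ltW.
  rewrite /z mxE mulrDr addrAC -[X in `|X|]addrC (le_trans (ler_normD _ _))// lerD//.
    rewrite mxE mulrN normrN normrM ger0_norm ?invr_ge0// mulrC.
    by rewrite ler_pM// coord_norm_le.
  rewrite distrC; apply: ltW; apply: le_lt_trans (kP j).2.
  have := coord_norm_le (a - (k j)%:R^-1 *: flow b (k j)%:R x) i.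
  by rewrite !mxE.
have [mu [mu1 muint]] := mean_representation mL.
exists mu.
  split=> // t psi Cpsi.
  by rewrite (muint _ (C0_sharp_flow hb t Cpsi)) muint// inv.
by apply/rowP => i; rewrite mxE muint ?field//; exact: C0_sharp_field.
Qed.

End krylov_bogoliubov.

(** * A single limit point determines the rotation set *)

(** The selection S is either everything, for the existence of limit points, or the set
    of terms that stay away from a given limit. *)
Lemma bounded_subsequence_limit (R : realType) (d : nat) (v : nat -> 'rV[R]_d)
    (M : R) (S : nat -> Prop) :
  (forall n, `|v n| <= M) -> (forall m : nat, exists2 n, (m <= n)%N & S n) ->
  exists c, forall (e : R) (m : nat), 0 < e ->
    exists2 n, (m <= n)%N & S n /\ `|c - v n| < e.
Proof.
move=> vM inf.
have /choice[k kP] : forall m : nat, exists n, (m <= n)%N /\ S n.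
  by move=> m; have [n mn Sn] := inf m; exists n.
have K : compact [set w : 'rV[R]_d | `|w| <= M].
  apply: bounded_closed_compact.
    exists M; split; first exact: num_real.
    by move=> y My w /= wM; exact: le_trans wM (ltW My).
  apply: (@closed_comp _ _ (fun w : 'rV[R]_d => `|w|) [set r | r <= M]).
    by move=> w _; exact: norm_continuous.
  exact: closed_le.
have FK : ((v \o k) @ \oo) [set w | `|w| <= M] by exists 0%N => // n _; exact: vM.
have [c [_ cv]] := K _ (fmap_proper_filter (v \o k) eventually_filter) FK.
exists c => e m e0.
have Fm : ((v \o k) @ \oo) ((v \o k) @` [set j | (m <= j)%N]).
  by exists m => // j mj; exists j.
have [w [[j mj <-] cw]] := cv _ _ Fm (nbhsx_ballx c e e0).
exists (k j); first exact: leq_trans mj (kP j).1.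
by split; [exact: (kP j).2|move: cw; rewrite -ball_normE].
Qed.

Section rotation.
Variables (R : realType) (d : nat) (b : 'rV[R]_d -> 'rV[R]_d).
Hypothesis hb : lipschitz_field b.

Lemma flow_ratio_bounded (M : R) (x : 'rV[R]_d) (k : nat) : (forall x, `|b x| <= M) ->
  `|k%:R^-1 *: (flow b k%:R x - x)| <= M.
Proof.
move=> bM; have M0 : 0 <= M by exact: le_trans (bM 0).
have [->|k0] := posnP k; first by rewrite invr0 scale0r normr0.
have kp : 0 < k%:R :> R by rewrite ltr0n.
rewrite normrZ ger0_norm ?invr_ge0 ?ler0n// ler_pdivrMl// mulrC.
have := flow_speed hb x 0 k%:R bM.
by rewrite (flow0 hb) subr0 ger0_norm ?ler0n.
Qed.

Lemma limit_point_exists (x : 'rV[R]_d) (S : nat -> Prop) :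
  (forall m : nat, exists2 n, (m <= n)%N & S n) ->
  exists c, forall (e : R) (m : nat), 0 < e ->
    exists2 n, (m <= n)%N & S n /\ `|c - n%:R^-1 *: flow b n%:R x| < e.
Proof.
move=> inf; have [M M0 bM] : exists2 M : R, 0 < M & forall x, `|b x| <= M by case: hb.
apply: (@bounded_subsequence_limit _ _ _ (M + `|x|)) inf => n.
rewrite -[flow b _ x](subrK x) scalerDr (le_trans (ler_normD _ _))//.
apply: lerD (flow_ratio_bounded x n bM) _.
rewrite normrZ ger0_norm ?invr_ge0 ?ler0n// ler_piMl//.
by case: n => [|n]; rewrite ?invr0// invf_le1 ?ltr0n// ler1n.
Qed.

Lemma asymptotic_nonempty : asymptotic_set b !=set0.
Proof.
have [|c cP] := @limit_point_exists 0 (fun=> True); first by move=> m; exists m.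
exists c; apply/asymptotic_setP; exists 0.
  by move=> i; rewrite mxE lexx ltr01.
by move=> e n e0; have [k nk [_ ck]] := cP e n e0; exists k.
Qed.

(** Otherwise the terms far from a would have a limit point, and it would belong to the
    asymptotic set. *)
Lemma asymptotic_cvg (a x : 'rV[R]_d) : asymptotic_set b `<=` [set a] -> torus R d x ->
  n%:R^-1 *: (flow b n%:R x - x) @[n --> \oo] --> a.
Proof.
move=> Aa xT.
have -> : (fun n : nat => n%:R^-1 *: (flow b n%:R x - x)) =
    (fun n : nat => n%:R^-1 *: flow b n%:R x - n%:R^-1 *: x).
  by apply/funext => n; rewrite scalerBr.
rewrite -[a]subr0; apply: cvgB; last first.
  rewrite -(scale0r x); apply: cvgZr_tmp; apply: (@cvg_inv_nat _ 2) => n.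
  rewrite subr0; case: n => [|n]; first by rewrite invr0 normr0 divr_ge0.
  rewrite ger0_norm ?invr_ge0// ler_pdivlMr ?ltr0n// mulrC ler_pdivrMr ?ltr0n//.
  by rewrite -natrM ler_nat; lia.
apply/cvgrPdist_lt => e e0; apply: contrapT => nc.
have [|c cP] := @limit_point_exists x
    (fun n => e <= `|a - n%:R^-1 *: flow b n%:R x|).
  move=> m; apply: contrapT => nm; apply: nc; exists m => // n /= mn.
  by rewrite ltNge; apply/negP => h; apply: nm; exists n.
have /Aa ca : asymptotic_set b c.
  apply/asymptotic_setP; exists x => // e' n e'0.
  by have [k nk [_ ck]] := cP e' n e'0; exists k.
have [n _ []] := cP e 0%N e0; rewrite ca => h1 h2.
by have := le_lt_trans h1 h2; rewrite ltxx.
Qed.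

(** For an invariant measure the integral c t of the displacement X (t, y) - y is additive
    in t, so that n c (1 / n) = c 1 = c n / n.  By dominated convergence the left-hand
    side tends to the integral of the field and the right-hand side to a. *)
Theorem rotation_sub_asymptotic a : asymptotic_set b `<=` [set a] ->
  rotation_set b `<=` [set a].
Proof.
move=> Aa _ [mu [mu1 inv] <-]; apply/rowP => i; rewrite mxE.
have [[M M0 bM] [L L0 bL]] : (exists2 M : R, 0 < M & forall x, `|b x| <= M) /\
  (exists2 L : R, 0 < L & forall x y, `|b x - b y| <= L * `|x - y|) by case: hb.
have mT := @measurable_torus R d.
have mC0 phi : C0_sharp R d phi -> measurable_fun (torus R d : set (borelRd R d)) phi.
  by move=> [/continuous_borel mphi _]; exact: measurable_funTS.
have iC0 phi : C0_sharp R d phi -> mu.-integrable (torus R d) (EFin \o phi).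
  move=> Cphi; have [B _ HB] := C0_sharp_bounded Cphi.
  by apply: (@bounded_integrable _ _ _ mu _ phi B) => //; exact: mC0.
pose D t (y : 'rV[R]_d) := (flow b t y - y) 0 i.
have CD t : C0_sharp R d (D t) by exact: C0_sharp_displacement.
pose c t := \int[mu]_(y in torus R d) D t y.
have cD s t : c (s + t) = c s + c t.
  rewrite /c -(inv t _ (CD s)) -RintegralD//; last 2 first.
    exact: (iC0 _ (C0_sharp_flow hb t (CD s))).
    exact: iC0.
  apply: eq_Rintegral => y _; rewrite /D (flowD hb).
  by rewrite !mxE addrA subrK.
have cM n t : c (n%:R * t) = n%:R * c t.
  elim: n => [|n IH]; last by rewrite -natr1 !mulrDl !mul1r cD IH.
  by rewrite !mul0r; have := cD 0 0; rewrite addr0; lra.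
have iZ (r t : R) : \int[mu]_(y in torus R d) (r * D t y) = r * c t.
  by rewrite RintegralZl//; exact: iC0.
have mZ (r t : R) : measurable_fun (torus R d : set (borelRd R d)) (fun y => r * D t y).
  by apply: measurable_funM => //; exact: mC0.
have conv (r t : nat -> R) (f : 'rV[R]_d -> R) :
    measurable_fun (torus R d : set (borelRd R d)) f ->
    (forall n y, `|r n * D (t n) y| <= M) ->
    (forall n, r n * c (t n) = c 1) ->
    (forall y, torus R d y -> r n * D (t n) y @[n --> \oo] --> f y) ->
    \int[mu]_(y in torus R d) f y = c 1.
  move=> mf bd rt cv.
  have := @bounded_convergence _ _ _ mu (torus R d) (fun n y => r n * D (t n) y) f M
    mT (fun n => mZ _ _) mf (fun n y _ => bd n y) cv.
  rewrite (_ : (fun n => _) = cst (c 1)); last first.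
    by apply/funext => n; rewrite iZ rt.
  by move=> /(cvg_unique _ (@cvg_cst _ _ _ _ _ )) -> //.
(* n * D (1 / n) converges to the field *)
have int_field : \int[mu]_(y in torus R d) b y 0 i = c 1.
  apply: (conv (fun n => n.+1%:R) (fun n => n.+1%:R^-1)).
  - exact: (mC0 _ (C0_sharp_field hb i)).
  - move=> n y.
    have := flow_speed hb y 0 n.+1%:R^-1 bM; rewrite (flow0 hb) subr0 => h.
    rewrite normrM ger0_norm ?ler0n// -ler_pdivlMl ?ltr0n// mulrC.
    apply: le_trans (coord_norm_le _ _) (le_trans h _).
    by rewrite ger0_norm// invr_ge0.
  - by move=> n; rewrite -cM mulfV// pnatr_eq0.
  - move=> y _; apply: (@cvg_inv_nat _ (L * M)) => n.
    have h0 : 0 <= n.+1%:R^-1 :> R by rewrite invr_ge0.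
    have := displacement_field hb y h0 bM L0 bL.
    move=> /(le_trans (coord_norm_le _ i)).
    rewrite [X in `|X| <= _]mxE [X in _ + X]mxE [X in _ - X]mxE => h.
    rewrite -[leLHS](_ : n.+1%:R * `|D n.+1%:R^-1 y - n.+1%:R^-1 * b y 0 i| = _).
      rewrite -ler_pdivlMl ?ltr0n//; apply: le_trans h _.
      by rewrite mulrC -mulrA.
    rewrite -{1}(ger0_norm (ler0n R n.+1)) -normrM mulrBr; congr (`|_ - _|).
    by rewrite mulrA mulfV ?mul1r ?pnatr_eq0.
(* D n / n converges to the constant a *)
have int_limit : \int[mu]_(y in torus R d) (cst (a 0 i)) y = c 1.
  apply: (conv (fun n => n.+1%:R^-1) (fun n => n.+1%:R)).
  - exact: measurable_cst.
  - move=> n y; have := flow_ratio_bounded y n.+1 bM.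
    by move=> /(le_trans (coord_norm_le _ i)); rewrite mxE.
  - by move=> n; rewrite -[X in c X]mulr1 cM mulrA mulVf ?mul1r ?pnatr_eq0.
  - move=> y yT; have /cvgrPdist_le H := asymptotic_cvg Aa yT.
    apply/cvgrPdist_le => e e0; have [N _ HN] := H e e0.
    exists N => // n /= Nn; have := HN n.+1 (leqW Nn).
    move=> /(le_trans (coord_norm_le _ i)); rewrite mxE [X in _ + X]mxE.
    by rewrite [X in _ - X]mxE.
rewrite int_field -int_limit Rintegral_cst//.
transitivity (a 0 i * fine 1%E); last by rewrite mulr1.
by congr (_ * fine _); exact: mu1.
Qed.

End rotation.

(** * Time change *)

Lemma is_derive_comp_rV (R : realType) (d : nat) (f : R -> 'rV[R]_d) (s : R -> R)
    (t ds : R) (v : 'rV[R]_d) :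
  is_derive (s t) 1 f v -> is_derive t 1 s ds ->
  is_derive t 1 (fun r => f (s r)) (ds *: v).
Proof.
move=> /is_derive_rVP Df Ds; apply/is_derive_rVP => i; rewrite mxE mulrC.
exact: (@is_derive1_comp _ (fun r => f r 0 i) s t _ _ (Df i) Ds).
Qed.

Section time_change.
Variables (R : realType) (d : nat) (b b' : 'rV[R]_d -> 'rV[R]_d) (c : 'rV[R]_d -> R).
Variable dl : R.
Hypotheses (hb : lipschitz_field b) (hb' : lipschitz_field b').
Hypotheses (cc : continuous c) (c1 : forall x, `|c x - 1| <= dl) (dl1 : dl <= 1).
Hypothesis bE : forall x, b x = c x *: b' x.

(** The new time s is the integral of c along the orbit of x under b.  Both X (t, x) and
    the reparametrized orbit of b' solve the equation z' = c (X (t, x)) b' (z) with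
    the same initial value, and Gronwall's inequality identifies them. *)
Lemma time_change (x : 'rV[R]_d) (t : R) : 0 <= t ->
  exists s, flow b t x = flow b' s x /\ `|s - t| <= dl * t.
Proof.
move=> t0; pose g s := c (flow b s x).
have cg : continuous g.
  move=> s; apply: (@continuous_comp _ _ _ (fun s => flow b s x) c); last exact: cc.
  have D : is_derive s 1 (fun s => flow b s x) (b (flow b s x)) by exact: flow_solution.
  by apply: differentiable_continuous; apply/derivable1_diffP; case: D.
pose sg := primitive g.
have Dsg (s : R) : is_derive s 1 sg (g s) by exact: is_derive_primitive.
exists (sg t); split; last first.
  have c12 s : - dl <= g s - 1 <= dl by rewrite -ler_norml; exact: c1.
  rewrite -[sg t - t](_ : sg t - sg 0 - t = _); last by rewrite /sg primitive0 subr0.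
  rewrite ler_norml; apply/andP; split.
    have := @le_increment _ (fun s => (1 - dl) * s) sg (fun=> 1 - dl) g 0 t t0
      (is_derive_mull (1 - dl)) Dsg.
    have H s : 0 <= s <= t -> 1 - dl <= g s by have /andP[] := c12 s; lra.
    by move=> /(_ H); rewrite mulr0 subr0; lra.
  have := @le_increment _ sg (fun s => (1 + dl) * s) g (fun=> 1 + dl) 0 t t0
    Dsg (is_derive_mull (1 + dl)).
  have H s : 0 <= s <= t -> g s <= 1 + dl by have /andP[] := c12 s; lra.
  by move=> /(_ H); rewrite mulr0 subr0; lra.
have [[M M0 bM] [L L0 bL]] : (exists2 M : R, 0 < M & forall x, `|b' x| <= M) /\
  (exists2 L : R, 0 < L & forall x y, `|b' x - b' y| <= L * `|x - y|) by case: hb'.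
pose f s := flow b s x - flow b' (sg s) x.
pose df s := g s *: (b' (flow b s x) - b' (flow b' (sg s) x)).
have Df (s : R) : is_derive s 1 f (df s).
  have D1 : is_derive s 1 (fun s => flow b s x) (b (flow b s x)) by exact: flow_solution.
  have D2 := is_derive_comp_rV (flow_solution hb' x (sg s)) (Dsg s).
  rewrite /df scalerBr -[g s *: b' (flow b s x)]/(c _ *: _) -bE.
  exact: (is_deriveB D1 D2).
have g2 s : `|g s| <= 2.
  have := c1 (flow b s x); rewrite -/(g s) => h.
  rewrite -[g s](subrK 1) (le_trans (ler_normD _ _))// normr1.
  have := le_trans h dl1; lra.
have dfM s : `|df s| <= 2 * (M + M).
  rewrite normrZ ler_pM// (le_trans (ler_normB _ _))// lerD//.
have dfL s : `|df s| <= 2 * L * `|f s|.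
  by rewrite normrZ -mulrA ler_pM// bL.
have L20 : 0 < 2 * L by rewrite mulr_gt0.
have := gronwall L20 Df dfM dfL t.
rewrite /f /sg primitive0 !flow0// subrr normr0 mulr0 mul0r normr_le0 subr_eq0.
by move=> /eqP.
Qed.

(** If the clocks differ by a factor within dl of 1, then X (k, x) is the point of the
    orbit of b' at a time s with |s - k| <= dl k.  Since that orbit is close to s a at
    time s, and |a| <= M, dividing by k leaves an error dl M in the limit. *)
Lemma asymptotic_time_change (M : R) (a p : 'rV[R]_d) : 0 <= dl ->
  (forall x, `|b' x| <= M) -> asymptotic_set b' `<=` [set a] -> asymptotic_set b p ->
  `|p - a| <= dl * M.
Proof.
move=> dl0 bM Aa /asymptotic_setP[x xT xp].
have M0 : 0 <= M by exact: le_trans (bM 0).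
have cva := asymptotic_cvg hb' Aa xT.
have aM : `|a| <= M.
  apply/ler_addgt0Pr => e e0; have /cvgrPdist_le/(_ e e0)[N _ HN] := cva.
  rewrite -[a](subrK (N%:R^-1 *: (flow b' N%:R x - x))) (le_trans (ler_normD _ _))//.
  by rewrite addrC lerD ?flow_ratio_bounded//; apply: HN => /=.
apply/ler_addgt0Pr => e e0.
have e4 : 0 < e / 4 by rewrite divr_gt0.
have e8 : 0 < e / 8 by rewrite divr_gt0.
have /cvgrPdist_le/(_ _ e8)[N _ HN] := cva.
(* C collects the error terms that do not grow with k: the fractional part of s,
   the first N terms before convergence sets in, and the initial point *)
pose C := M + 2 * M * N%:R + M + `|x|.
have C0 : 0 <= C by rewrite !addr_ge0// !mulr_ge0.
pose n0 := (Num.truncn (C / (e / 4))).+1.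
have [k nk pk] := xp (e / 4) n0 e4.
have k0 : (0 < k)%N by exact: leq_trans nk.
have kp : 0 < k%:R :> R by rewrite ltr0n.
have Ck : C / k%:R <= e / 4.
  rewrite ler_pdivrMr// mulrC -ler_pdivrMr//.
  apply: (@le_trans _ _ n0%:R); last by rewrite ler_nat.
  by rewrite /n0; apply: ltW; rewrite -real_truncn_le_nat ?num_real.
have [s [fs sk]] := time_change x (ltW kp).
have s0 : 0 <= s.
  have : - (dl * k%:R) <= s - k%:R by move: sk; rewrite ler_norml => /andP[].
  have : dl * k%:R <= k%:R by rewrite ler_piMl// ltW.
  lra.
pose m := Num.truncn s.
have /andP[m1 m2] : m%:R <= s < m.+1%:R by rewrite truncn_itv.
have H1 : `|flow b' s x - flow b' m%:R x| <= M.
  apply: le_trans (flow_speed hb' _ _ _ bM) _; rewrite ler_piMr// ger0_norm ?subr_ge0//.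
  by rewrite lerBlDr addrC natr1 ltW.
have H2 : `|flow b' m%:R x - x - m%:R *: a| <= e / 8 * m%:R + 2 * M * N%:R.
  have [->|mp] := posnP m.
    rewrite flow0// subrr scale0r subrr normr0 mulr0 add0r !mulr_ge0//.
  have mp' : 0 < m%:R :> R by rewrite ltr0n.
  have -> : flow b' m%:R x - x - m%:R *: a =
      m%:R *: (m%:R^-1 *: (flow b' m%:R x - x) - a).
    by rewrite scalerBr scalerA mulfV ?scale1r// gt_eqF.
  rewrite normrZ ger0_norm ?ler0n//.
  have [Nm|mN] := leqP N m.
    rewrite -[leLHS]addr0; apply: lerD; last by rewrite !mulr_ge0.
    by rewrite mulrC ler_wpM2r ?ler0n// distrC; exact: HN.
  rewrite -[leLHS]add0r; apply: lerD; first by rewrite mulr_ge0 ?ler0n// ltW.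
  rewrite mulrC ler_pM//.
    rewrite (le_trans (ler_normB _ _))// mulr_natl mulr2n lerD//.
    exact: flow_ratio_bounded.
  by rewrite ler_nat ltnW.
have H3 : `|m%:R *: a - k%:R *: a| <= (dl * k%:R + 1) * M.
  rewrite -scalerBl normrZ ler_pM//.
  rewrite (le_trans (ler_distD s _ _))// addrC lerD// distrC ger0_norm ?subr_ge0//.
  by rewrite lerBlDr addrC natr1 ltW.
have main : `|flow b k%:R x - k%:R *: a| <=
    M + (e / 8 * m%:R + 2 * M * N%:R) + (dl * k%:R + 1) * M + `|x|.
  rewrite fs.
  have -> : flow b' s x - k%:R *: a = (flow b' s x - flow b' m%:R x) +
      (flow b' m%:R x - x - m%:R *: a) + (m%:R *: a - k%:R *: a) + x.
    by apply/rowP => i; rewrite !mxE; ring.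
  rewrite (le_trans (ler_normD _ _))// lerD// (le_trans (ler_normD _ _))// lerD//.
  by rewrite (le_trans (ler_normD _ _))// lerD.
have mk : m%:R <= 2 * k%:R :> R.
  apply: le_trans m1 _; move: sk; rewrite ler_norml => /andP[_ h].
  have : dl * k%:R <= k%:R by rewrite ler_piMl// ltW.
  lra.
have main2 : `|k%:R^-1 *: flow b k%:R x - a| <= dl * M + e / 4 + C / k%:R.
  have -> : k%:R^-1 *: flow b k%:R x - a = k%:R^-1 *: (flow b k%:R x - k%:R *: a).
    by rewrite scalerBr scalerA mulVf ?scale1r// gt_eqF.
  rewrite normrZ ger0_norm ?invr_ge0 ?ler0n// ler_pdivrMl//.
  apply: le_trans main _.
  have -> : k%:R * (dl * M + e / 4 + C / k%:R) = k%:R * dl * M + e / 4 * k%:R + C.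
    by field; rewrite gt_eqF.
  have : e / 8 * m%:R <= e / 8 * (2 * k%:R) by rewrite ler_wpM2l// ltW.
  rewrite /C; lra.
rewrite (le_trans (ler_distD (k%:R^-1 *: flow b k%:R x) _ _))//.
move: (ltW pk) main2 Ck; set u := `|p - _|; set v := `|_ - a|; lra.
Qed.

End time_change.

(** * Densities with a single rotation vector *)

Lemma card_singletonP (T : Type) (A : set T) : A #= `I_1 <-> exists a, A = [set a].
Proof.
split=> [|[a ->]]; last exact: card_set1.
move=> /card_set_bijP[f [funf injf surf]].
have [a Aa fa] := surf 0%N isT; exists a; apply/seteqP; split=> [x Ax|x -> //].
apply: injf; rewrite ?inE// fa.
by have := funf x Ax; rewrite /=; case: (f x).
Qed.

Lemma singleton_rotation_asymptotic (R : realType) (d : nat) (b : 'rV[R]_d -> 'rV[R]_d) :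
  lipschitz_field b ->
  (rotation_set b #= `I_1 <-> asymptotic_set b #= `I_1).
Proof.
move=> hb; have AC := asymptotic_sub_rotation hb.
have [p Ap] := asymptotic_nonempty hb.
split=> /card_singletonP[a E]; apply/card_singletonP; exists a.
  apply/seteqP; split=> [q /AC|q ->]; rewrite ?E//.
  by have := AC _ Ap; rewrite E => /= <-.
apply/seteqP; split; first by apply: (rotation_sub_asymptotic hb); rewrite E.
by rewrite -E.
Qed.

Lemma uniform_approximation (R : realType) (d : nat) (P S : set ('rV[R]_d -> R))
    (rho : 'rV[R]_d -> R) (e : R) :
  P rho -> closure (S : set (subspace (P : set {uniform 'rV[R]_d -> R}))) rho -> 0 < e ->
  exists2 rho', S rho' & forall x, `|rho x - rho' x| < e.
Proof.
move=> Prho clS e0.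
pose B := [set h : 'rV[R]_d -> R | forall x, `|rho x - h x| < e].
have /clS[h [Sh Bh]] : nbhs (rho : subspace (P : set {uniform 'rV[R]_d -> R})) B.
  apply/nbhs_subspace_ex => //; exists B => //.
  apply/uniform_nbhs; exists [set xy | ball xy.1 e xy.2]; split.
    exact: (@entourage_ball R R (PosNum e0)).
  by move=> h Bh x; have := Bh x Logic.I; rewrite /= -ball_normE.
by exists h.
Qed.

(** Each approximation rho' has a single limit point a, and the time change from rho' to
    rho displaces limit points by at most dl M, where dl is a bound for
    |rho / rho' - 1| and M one for rho' Phi.  Thus p and q are within 2 dl M of each
    other, and dl tends to 0 because rho is bounded away from 0. *)
Lemma asymptotic_limit_unique (R : realType) (d : nat) (Phi : 'rV[R]_d -> 'rV[R]_d)
    (rho : 'rV[R]_d -> R) :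
  C1_sharp_field Phi -> C1_sharp_pos R d rho ->
  (forall e : R, 0 < e -> exists rho', [/\ C1_sharp_pos R d rho',
     asymptotic_set (scale_field rho' Phi) #= `I_1 & forall x, `|rho x - rho' x| < e]) ->
  forall p q, asymptotic_set (scale_field rho Phi) p ->
    asymptotic_set (scale_field rho Phi) q -> p = q.
Proof.
move=> CPhi [Crho rho0] approx p q Ap Aq.
have hb := scale_field_lipschitz Crho CPhi.
have [B0 [[cinv pinv] B0P]] : exists g : 'rV[R]_d -> R, C0_sharp R d g /\
    forall x, g x = (rho x)^-1.
  exists (fun x => (rho x)^-1); split=> //; have [crho prho] := C1_sharp_C0 Crho.
  split=> [x|x k]; last by rewrite prho.
  exact: (cvgV (lt0r_neq0 (rho0 x)) (crho x)).
have [B Bp HB] := C0_sharp_bounded (conj cinv pinv).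
have rhoB x : B^-1 <= rho x.
  have := HB x; rewrite B0P ger0_norm ?invr_ge0 ?(ltW (rho0 x))// => h.
  by rewrite -[rho x]invrK lef_pV2 ?posrE ?invr_gt0.
have [A A0 rhoA] := C0_sharp_bounded (C1_sharp_C0 Crho).
have [K [K0 PhiK]] : exists K : R, 0 < K /\ forall x, `|Phi x| <= K.
  have [_ [K K0 H] _] := scale_field_lipschitz Crho CPhi.
  exists (B * K); split=> [|x]; first exact: mulr_gt0.
  have -> : Phi x = (rho x)^-1 *: (scale_field rho Phi x).
    by rewrite /scale_field scalerA mulVf ?scale1r// gt_eqF.
  by rewrite normrZ ler_pM// -B0P.
apply/eqP; rewrite -subr_eq0 -normr_le0.
apply/ler_addgt0Pr => e e0; rewrite add0r.
pose M := (A + 1) * K; have M0 : 0 < M by rewrite mulr_gt0// addr_gt0.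
(* eps <= 1 gives the bound M on rho' Phi, eps <= 1 / (2 B) keeps rho' above
   1 / (2 B), and the last bound makes dl * M at most e / 2 *)
pose eps := Num.min 1 (Num.min ((2 * B)^-1) (e / (4 * B * M))).
have BM0 : 0 < 4 * B * M by rewrite mulr_gt0// mulr_gt0.
have eps0 : 0 < eps by rewrite !lt_min ltr01 invr_gt0 mulr_gt0//= divr_gt0.
have [rho' [[Crho' rho'0] card' close]] := approx eps eps0.
have /card_singletonP[a Aa] := card'.
have e1 : eps <= 1 by rewrite /eps ge_min lexx.
have e2 : eps <= (2 * B)^-1 by rewrite /eps !ge_min lexx orbT.
have e3 : eps <= e / (4 * B * M) by rewrite /eps !ge_min lexx !orbT.
have rho'B x : (2 * B)^-1 <= rho' x.
  have := close x; rewrite ltr_norml => /andP[h1 h2].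
  have := rhoB x; have -> : B^-1 = (2 * B)^-1 + (2 * B)^-1 by field; rewrite gt_eqF.
  lra.
pose c x := rho x / rho' x.
pose dl := 2 * B * eps.
have c1 x : `|c x - 1| <= dl.
  have -> : c x - 1 = (rho x - rho' x) / rho' x by rewrite /c; field; rewrite gt_eqF.
  rewrite normrM mulrC /dl ler_pM// ?(ltW (close x))//.
  rewrite ger0_norm ?invr_ge0 ?(ltW (rho'0 x))// -[X in _ <= X]invrK.
  by rewrite lef_pV2 ?posrE// invr_gt0 mulr_gt0.
have dl1 : dl <= 1.
  by rewrite /dl mulrC -ler_pdivlMr ?mulr_gt0// div1r.
have dl0 : 0 <= dl by rewrite !mulr_ge0// ltW.
have cc : continuous c.
  have [crho _] := C1_sharp_C0 Crho; have [crho' _] := C1_sharp_C0 Crho'.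
  by move=> x; exact: (cvgM (crho x) (cvgV (lt0r_neq0 (rho'0 x)) (crho' x))).
have bE x : scale_field rho Phi x = c x *: scale_field rho' Phi x.
  by rewrite /scale_field scalerA /c divfK// gt_eqF.
have bM x : `|scale_field rho' Phi x| <= M.
  rewrite normrZ ler_pM//.
  rewrite -[rho' x](subrK (rho x)) addrC (le_trans (ler_normD _ _))// lerD// distrC.
  exact: le_trans (ltW (close x)) e1.
have Aa' : asymptotic_set (scale_field rho' Phi) `<=` [set a] by rewrite Aa.
have hb' := scale_field_lipschitz Crho' CPhi.
have close_a r : asymptotic_set (scale_field rho Phi) r -> `|r - a| <= dl * M.
  exact: (asymptotic_time_change hb hb' cc c1 dl1 bE dl0 bM Aa').
rewrite (le_trans (ler_distD a _ _))//.
have h1 := close_a _ Ap; have h2 := close_a _ Aq; rewrite distrC in h2.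
have h3 : dl * M <= e / 2.
  rewrite /dl; have -> : 2 * B * eps * M = eps * (4 * B * M) / 2 by field.
  by rewrite ler_wpM2r ?invr_ge0// -ler_pdivlMr.
rewrite (splitr e); exact: lerD (le_trans h1 h3) (le_trans h2 h3).
Qed.

Unset Implicit Arguments.

Theorem corollary3p1 (R : realType) (d : nat)
    (Phi : 'rV[R]_d -> 'rV[R]_d)
    (hPhi : C1_sharp_field Phi)
    (hPhi0 : forall x : 'rV[R]_d, Phi x != 0) :
  [set rho : 'rV[R]_d -> R | C1_sharp_pos R d rho /\
     rotation_set (scale_field rho Phi) #= `I_1] =
  [set rho : 'rV[R]_d -> R | C1_sharp_pos R d rho /\
     asymptotic_set (scale_field rho Phi) #= `I_1]
  /\
  uniformly_closed_in (C1_sharp_pos R d)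
    [set rho : 'rV[R]_d -> R | C1_sharp_pos R d rho /\
       rotation_set (scale_field rho Phi) #= `I_1].
Proof.
have equiv rho : C1_sharp_pos R d rho ->
    (rotation_set (scale_field rho Phi) #= `I_1 <->
     asymptotic_set (scale_field rho Phi) #= `I_1).
  move=> [Crho _]; apply: singleton_rotation_asymptotic.
  exact: scale_field_lipschitz.
split.
  by apply/seteqP; split=> rho /= [Crho] /(equiv _ Crho).
split=> [rho []//|rho clS].
(* the points outside C1_sharp_pos are isolated in the subspace topology *)
have Prho : C1_sharp_pos R d rho.
  apply: contrapT => nP.
  have /clS[h [[Ph _] /= hrho]] : nbhs (rho : subspace
      (C1_sharp_pos R d : set {uniform 'rV[R]_d -> R})) [set rho].
    by rewrite /nbhs /= -nbhs_subspace_out.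
  by apply: nP; rewrite -hrho.
split=> //; apply/(equiv _ Prho)/card_singletonP.
have hb := scale_field_lipschitz Prho.1 hPhi.
have [p Ap] := asymptotic_nonempty hb.
exists p; apply/seteqP; split=> [q Aq|q -> //].
apply: (asymptotic_limit_unique hPhi Prho) => // e e0.
have [rho' [Prho' card'] close] := uniform_approximation Prho clS e0.
by exists rho'; split=> //; apply/(equiv _ Prho').
Qed.
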